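(* Let $\Gamma$ be a finite tree having an essential vertex, let $m(\Gamma)$ be the number of its essential vertices, and let $n\ge 1$ be an integer. Then $$\mathsf{TC}(F(\Gamma,n))\le 2m(\Gamma)+1.$$
   Context: A tree is viewed as a topological space (1-dimensional finite cell complex). An essential vertex of a graph is a vertex incident to at least 3 edges. $F(\Gamma,n)=\{(z_1,\dots,z_n)\in\Gamma^n : z_i\ne z_j \text{ for } i\ne j\}$ is the configuration space of $n$ distinct ordered points on $\Gamma$, with the topology induced from $\Gamma^n$. For a path-connected topological space $X$, let $PX=X^{[0,1]}$ be the space of continuous paths in $X$ with the compact-open topology, and let $\pi: PX\to X\times X$, $\pi(\gamma)=(\gamma(0),\gamma(1))$. The topological complexity $\mathsf{TC}(X)$ is the minimal integer $k$ such that $X\times X=U_1\cup\dots\cup U_k$ with each $U_i$ open in $X\times X$ and admitting a continuous map $s_i:U_i\to PX$ with $\pi\circ s_i=\mathrm{id}_{U_i}$; if no such $k$ exists, $\mathsf{TC}(X)=\infty$. *)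

(* Defs.v *)
From HB Require Import structures.
From mathcomp Require Import all_boot all_order all_algebra.
From mathcomp Require Import all_classical all_reals all_analysis.

Set Implicit Arguments.
Unset Strict Implicit.
Unset Printing Implicit Defensive.

Import Order.TTheory GRing.Theory Num.Theory.
Import numFieldNormedType.Exports.

Local Open Scope classical_set_scope.
Local Open Scope ring_scope.

Section Graphs.
Variables (V : finType) (e : rel V).

Definition connected_graph := forall u v : V, connect e u v.

(* In a simple graph the only duplicate-free [cycle]s of length at most 2 are
   the empty one and the back-and-forth traversals [:: u; v] of an edge. *)
Definition acyclic_graph := forall c : seq V, ucycle e c -> (size c <= 2)%N.

Definition is_tree :=
  [/\ symmetric e, irreflexive e, connected_graph & acyclic_graph].

Definition essential (v : V) : bool := (3 <= #|[pred u | e v u]|)%N.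

Definition num_essential : nat := #|[pred v | essential v]|.

End Graphs.

(* The geometric realization of a simple graph as a 1-dimensional simplicial
   complex in R^V, in barycentric coordinates: the basis vectors are the
   vertices, and the segments joining adjacent basis vectors are the edges.
   Since a tree has neither loops nor multiple edges, this is its usual
   realization as a 1-dimensional finite cell complex. *)
Definition realization_set (R : realType) (V : finType) (e : rel V) :
    set {ptws V -> R} :=
  [set x | [/\ forall w, 0 <= x w,
               \sum_(w : V) x w = 1 &
               exists u v : V, (u = v \/ e u v) /\
                 forall w, w != u -> w != v -> x w = 0]].

Arguments realization_set R {V} e.

Definition realization (R : realType) (V : finType) (e : rel V)
  : topologicalType := set_type (realization_set R e).

Definition configuration_space (X : topologicalType) (n : nat)
  : topologicalType :=
  set_type [set z : {ptws 'I_n -> X} | forall i j, i != j -> z i <> z j].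

Arguments realization R {V} e.

Section TopologicalComplexity.
Variable R : realType.

Definition unit_interval : topologicalType := set_type `[0 : R, 1]%classic.

Lemma unit_interval0 : 0 \in (`[0 : R, 1]%classic : set R).
Proof. by rewrite inE /= in_itv /= lexx ler01. Qed.

Lemma unit_interval1 : 1 \in (`[0 : R, 1]%classic : set R).
Proof. by rewrite inE /= in_itv /= lexx ler01. Qed.

Definition I0 : unit_interval := exist _ (0 : R) unit_interval0.

Definition I1 : unit_interval := exist _ (1 : R) unit_interval1.

Variable X : topologicalType.

(* The carrier of [{compact-open, _ -> _}] consists of all functions, so the
   continuous ones are cut out, with the subspace topology. *)
Definition path_space : topologicalType :=
  set_type [set f : {compact-open, unit_interval -> X}
           | continuous (f : unit_interval -> X)].

Definition endpoints (g : path_space) : X * X := (\val g I0, \val g I1).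

Definition has_local_section (U : set (X * X)) :=
  exists2 s : set_type U -> path_space,
    continuous s & forall u, endpoints (s u) = \val u.

Definition motion_cover (k : nat) :=
  exists U : 'I_k -> set (X * X),
    [/\ forall i, open (U i),
        \bigcup_(i in [set: 'I_k]) U i = [set: X * X] &
        forall i, has_local_section (U i)].

(* The infimum of a nonempty set of naturals is its minimum, and that of the
   empty set is [+oo], so this is the least [k] with a motion cover of size
   [k], or [+oo] if there is none. *)
Definition TC : \bar R := ereal_inf [set k%:R%:E | k in motion_cover].

End TopologicalComplexity.

Arguments TC R X : clear implicits.

(* Main.v *)
(* The essential vertices occupied in a configuration, and in a pair of
   configurations, form a finite set W. Pairs with #|W| = r, for r = 0 .. 2m,
   partition F x F into 2m + 1 sets, and each of them has an open neighbourhood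
   that is still a disjoint union over the sets W of size r. A local section
   over it is the same as a homotopy between the two projections, so it is
   enough to contract each factor to a constant there. If the particle closest
   to each vertex of W is first pushed onto it, then the remaining particles
   stay in the complement of the essential vertices, whose components are arcs.
   In a tree rooted at a leaf each arc is a descending chain, on which the
   depth is injective, so linear interpolation of depths moves a configuration,
   without collision, to any other one with the same arcs and the same orders
   on them. The finitely many reference configurations obtained this way are
   joined to a base point because F is path-connected.

   Path-connectedness goes by induction on n. The particle closest to the root
   leaf moves there, and with one particle at that leaf the others can be moved
   at will, by induction, after being pushed off the leaf. Two particles are
   exchanged at the leaf by using the two branches below an essential vertex. *)

Require Import Defs.
From mathcomp Require Import all_boot all_order all_algebra.
From mathcomp Require Import all_classical all_reals all_analysis.
From mathcomp Require Import zify ring lra.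

Set Implicit Arguments.
Unset Strict Implicit.
Unset Printing Implicit Defensive.

Import Order.TTheory GRing.Theory Num.Theory.
Import numFieldNormedType.Exports.

Local Open Scope classical_set_scope.
Local Open Scope ring_scope.

(** * Continuous maps into subspaces and products *)

Lemma continuous_into_set_type (T X : topologicalType) (A : set X)
    (f : T -> set_type A) :
  continuous (fun t => \val (f t)) -> continuous f.
Proof.
move=> cf x U /= [_ [[B oB <-]] /= Bfx BU].
by apply: (filterS BU); apply: cf; exact: open_nbhs_nbhs.
Qed.

Lemma continuous_set_val (X : topologicalType) (A : set X) :
  continuous (fun x : set_type A => \val x).
Proof. exact: initial_continuous. Qed.

Lemma continuous_into_ptws (T : topologicalType) (I : Type)
    (X : topologicalType) (f : T -> {ptws I -> X}) :
  (forall i, continuous (fun t => f t i)) -> continuous f.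
Proof.
move=> cf x; apply/cvg_sup => i U /= [_ [[B oB <-]] /= Bfx BU].
by apply: (filterS BU); apply: cf; exact: open_nbhs_nbhs.
Qed.

Lemma continuous_ptws_eval (I : eqType) (X : topologicalType) (i : I) :
  continuous (fun f : {ptws I -> X} => f i).
Proof. exact: (@proj_continuous I (fun=> X) i). Qed.

(** * Continuity *)

Section Locally_constant.
Variables (T : topologicalType).

Definition loc_const (K : Type) (c : T -> K) :=
  forall t, \forall u \near t, c u = c t.

(** Near [t] the function agrees with the single branch [phi (c t)]. Discrete choices can thus be
    treated as constants when continuity is checked. *)
Lemma loc_const_continuous (K : Type) (X : topologicalType) (c : T -> K)
    (phi : K -> T -> X) :
  loc_const c -> (forall k, continuous (phi k)) ->
  continuous (fun t => phi (c t) t).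
Proof.
move=> lc cphi t U Ut; have := cphi (c t) t _ Ut.
by move: (lc t); apply: filter_app2; apply: nearW => u /= ->.
Qed.

Lemma loc_const_comp (K L : Type) (g : K -> L) (c : T -> K) :
  loc_const c -> loc_const (fun t => g (c t)).
Proof. by move=> lc t; move: (lc t); apply: filterS => u ->. Qed.

Lemma loc_const_pair (K L : Type) (c : T -> K) (d : T -> L) :
  loc_const c -> loc_const d -> loc_const (fun t => (c t, d t)).
Proof.
move=> lc ld t; move: (lc t) (ld t).
by apply: filter_app2; apply: nearW => u -> ->.
Qed.

Lemma loc_const_ffun (I : finType) (K : Type) (c : I -> T -> K) :
  (forall i, loc_const (c i)) -> loc_const (fun t => [ffun i => c i t]).
Proof.
move=> lc t.
have : \forall u \near t, forall i, c i u = c i t.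
  by apply: filter_forall => i; exact: lc.
by apply: filterS => u cu; apply/ffunP => i; rewrite !ffunE.
Qed.

Lemma loc_const_bool (b : T -> bool) :
  (forall t, b t -> \forall u \near t, b u) ->
  (forall t, ~~ b t -> \forall u \near t, ~~ b u) -> loc_const b.
Proof.
move=> b1 b0 t; case bt : (b t).
  by move: (b1 _ bt); apply: filterS => u ->.
by move: (b0 _ (negbT bt)); apply: filterS => u /negbTE ->.
Qed.

(** Openness in boolean form, so that sets cut out by finite quantifiers are handled one connective
    at a time. *)
Definition open_pred (P : T -> bool) := forall t, P t -> \forall u \near t, P u.

Lemma open_pred_cst b : open_pred (fun=> b).
Proof. by move=> t bt; exact: nearW. Qed.

Lemma open_pred_and P Q :
  open_pred P -> open_pred Q -> open_pred (fun t => P t && Q t).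
Proof.
move=> oP oQ t /andP[Pt Qt]; move: (oP t Pt) (oQ t Qt).
by apply: filterS2 => u -> ->.
Qed.

Lemma open_pred_imply b P : open_pred P -> open_pred (fun t => b ==> P t).
Proof. by case: b => //= _ t _; exact: nearW. Qed.

Lemma open_pred_forall (I : finType) (P : I -> T -> bool) :
  (forall i, open_pred (P i)) -> open_pred (fun t => [forall i, P i t]).
Proof.
move=> oP t /forallP Pt.
have : \forall u \near t, forall i, P i u.
  by apply: filter_forall => i; exact: oP.
by apply: filterS => u Pu; exact/forallP.
Qed.

Lemma open_pred_exists (I : finType) (P : I -> T -> bool) :
  (forall i, open_pred (P i)) -> open_pred (fun t => [exists i, P i t]).
Proof.
move=> oP t /existsP[i Pt]; move: (oP i t Pt).
by apply: filterS => u Pu; apply/existsP; exists i.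
Qed.

End Locally_constant.

Lemma loc_const_cont (S T : topologicalType) (K : Type) (c : T -> K) (g : S -> T) :
  loc_const c -> continuous g -> loc_const (fun s => c (g s)).
Proof. by move=> lc cg s; exact: cg _ (lc (g s)). Qed.

Section Real_valued.
Variables (R : realType) (T : topologicalType).
Implicit Types f g : T -> R.

Lemma open_pred_lt f g :
  continuous f -> continuous g -> open_pred (fun t => f t < g t).
Proof.
move=> cf cg t fg.
have cgf : continuous (fun u => g u - f u).
  by move=> u; apply: cvgB; [exact: cg|exact: cf].
have : \forall u \near t, 0 < g u - f u.
  by apply: (cvgr_gt _ (cgf t)); rewrite subr_gt0.
by apply: filterS => u; rewrite subr_gt0.
Qed.

Lemma continuous_add f g : continuous f -> continuous g ->
  continuous (fun u => f u + g u).
Proof. by move=> cf cg u; apply: cvgD; [exact: cf|exact: cg]. Qed.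

Lemma continuous_sub f g : continuous f -> continuous g ->
  continuous (fun u => f u - g u).
Proof. by move=> cf cg u; apply: cvgB; [exact: cf|exact: cg]. Qed.

Lemma continuous_mul f g : continuous f -> continuous g ->
  continuous (fun u => f u * g u).
Proof. by move=> cf cg u; apply: cvgM; [exact: cf|exact: cg]. Qed.

Lemma continuous_cst (X : topologicalType) (c : X) :
  continuous (fun _ : T => c).
Proof. by move=> u; exact: cvg_cst. Qed.

Lemma continuous_bigsum (I : finType) (F : I -> T -> R) :
  (forall i, continuous (F i)) -> continuous (fun t => \sum_i F i t).
Proof.
move=> cF; apply: continuous_big => [|i _]; last exact: cF.
by move=> x; apply: cvgD; [exact: cvg_fst|exact: cvg_snd].
Qed.

Lemma continuous_maxr f g : continuous f -> continuous g ->
  continuous (fun u => Num.max (f u) (g u)).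
Proof. by move=> cf cg u; apply: continuous_max; [exact: cf|exact: cg]. Qed.

Lemma continuous_minr f g : continuous f -> continuous g ->
  continuous (fun u => Num.min (f u) (g u)).
Proof. by move=> cf cg u; apply: continuous_min; [exact: cf|exact: cg]. Qed.

Lemma continuous_absr f : continuous f -> continuous (fun u => `|f u|).
Proof.
by move=> cf u; apply: (continuous_comp (cf u)); exact: norm_continuous.
Qed.

End Real_valued.

Lemma continuous_comp_fun (S T X : topologicalType) (f : S -> T) (g : T -> X) :
  continuous f -> continuous g -> continuous (fun s => g (f s)).
Proof.
by move=> cf cg s; apply: (continuous_comp (cf s)); exact: cg.
Qed.

Lemma continuous_fst (S T : topologicalType) : continuous (@fst S T).
Proof. by move=> x; exact: cvg_fst. Qed.

Lemma continuous_snd (S T : topologicalType) : continuous (@snd S T).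
Proof. by move=> x; exact: cvg_snd. Qed.

Lemma continuous_pair (S T X : topologicalType) (f : S -> T) (g : S -> X) :
  continuous f -> continuous g -> continuous (fun s => (f s, g s)).
Proof. by move=> cf cg s; apply: cvg_pair; [exact: cf|exact: cg]. Qed.

(** For [d >= 0] this is the retraction of the line onto the interval from 0 to [d]. *)
Definition clamp (R : realType) (d s : R) := Num.max 0 (Num.min d s).

Section Clamp.
Variable R : realType.
Implicit Types d s : R.

Lemma continuous_clamp (T : topologicalType) d (f : T -> R) :
  continuous f -> continuous (fun t => clamp d (f t)).
Proof.
move=> cf; apply: continuous_maxr; first exact: continuous_cst.
by apply: continuous_minr => //; exact: continuous_cst.
Qed.

Lemma clamp_id d s : 0 <= s <= d -> clamp d s = s.
Proof. by case/andP=> s0 sd; rewrite /clamp (min_idPr sd) (max_idPr s0). Qed.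

Lemma clamp_le0 d s : s <= 0 -> clamp d s = 0.
Proof.
by move=> s0; apply/max_idPl; rewrite ge_min s0 orbT.
Qed.

Lemma clamp_ge d s : 0 <= d <= s -> clamp d s = d.
Proof. by case/andP=> d0 ds; rewrite /clamp (min_idPl ds) (max_idPr d0). Qed.

Lemma clamp_bounds d s : 0 <= d -> 0 <= clamp d s <= d.
Proof. by move=> d0; rewrite le_max lexx ge_max d0 ge_min lexx. Qed.

End Clamp.

(** * Homotopies of configurations *)

Section Configurations.
Variables (R : realType) (V : finType) (e : rel V) (n : nat).

Definition position (z : configuration_space (realization R e) n) (i : 'I_n)
  (w : V) : R := \val (\val z i) w.

(** Configurations in plain coordinates, so that motions can be given by formulas instead of
    elements of nested subtypes. *)
Definition is_conf (c : 'I_n -> V -> R) :=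
  (forall i, realization_set R e (c i)) /\
  (forall i j, i != j -> c i <> c j).

Lemma position_is_conf z : is_conf (position z).
Proof.
split=> [i|i j ij]; first exact: set_valP (\val z i).
move=> cij; have /(_ i j ij) := set_valP z; apply; exact: val_inj.
Qed.

Lemma position_inj z z' : position z = position z' -> z = z'.
Proof.
move=> cz; apply: val_inj; apply: functional_extensionality_dep => i.
by apply: val_inj; exact: (congr1 (fun f => f i) cz).
Qed.

Lemma position_surj c : is_conf c -> exists z, position z = c.
Proof.
move=> [cR cI].
pose y : {ptws 'I_n -> realization R e} := fun i =>
  (exist _ (c i) (mem_set (cR i)) : realization R e).
have yI : y \in [set z : {ptws 'I_n -> realization R e} |
                  forall i j, i != j -> z i <> z j].
  rewrite inE /= => i j /cI ij yij; apply: ij.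
  exact: (congr1 (fun x : realization R e => \val x) yij).
by exists (exist _ y yI).
Qed.

Lemma continuous_position i w : continuous (fun z => position z i w).
Proof.
have c1 := @continuous_comp_fun _ _ _ _ _
  (@continuous_set_val _ [set z : {ptws 'I_n -> realization R e} |
                          forall i j, i != j -> z i <> z j])
  (@continuous_ptws_eval 'I_n (realization R e) i).
have c2 := @continuous_comp_fun _ _ _ _ _ c1
  (@continuous_set_val _ (realization_set R e)).
exact: (@continuous_comp_fun _ _ _ _ _ c2 (@continuous_ptws_eval V R w)).
Qed.

Lemma continuous_into_conf (T : topologicalType)
    (f : T -> configuration_space (realization R e) n) :
  (forall i w, continuous (fun t => position (f t) i w)) -> continuous f.
Proof.
move=> cf; apply: continuous_into_set_type; apply: continuous_into_ptws => i.
apply: continuous_into_set_type; apply: continuous_into_ptws => w.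
exact: cf.
Qed.

Variable T : topologicalType.

(* Homotopies are kept in coordinates. They only have to take values in the
   configuration space at times in [0, 1]. *)
Definition homotopic (f g : T -> 'I_n -> V -> R) :=
  exists h : T -> R -> 'I_n -> V -> R,
    [/\ forall i w, continuous (fun x : T * R => h x.1 x.2 i w),
        forall t s, 0 <= s <= 1 -> is_conf (h t s),
        forall t, h t 0 = f t & forall t, h t 1 = g t].

Lemma homotopic_conf1 f g t : homotopic f g -> is_conf (g t).
Proof. by case=> h [_ hc _ <-]; apply: hc; rewrite ler01 lexx. Qed.

Lemma homotopic_continuous1 f g i w : homotopic f g ->
  continuous (fun t => g t i w).
Proof.
case=> h [hc _ _ h1].
have -> : (fun t => g t i w) = (fun t => h t 1 i w).
  by apply/funext => t /=; rewrite h1.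
apply: (@continuous_comp_fun _ _ _ (fun t => (t, (1 : R)))
         (fun x => h x.1 x.2 i w)); last exact: hc.
by apply: continuous_pair; [move=> t; exact: cvg_id|exact: continuous_cst].
Qed.

Lemma homotopic_refl f : (forall i w, continuous (fun t => f t i w)) ->
  (forall t, is_conf (f t)) -> homotopic f f.
Proof.
move=> cf cof; exists (fun t _ => f t); split=> // i w.
by apply: (@continuous_comp_fun _ _ _ fst (fun t => f t i w));
  [exact: continuous_fst|exact: cf].
Qed.

Lemma homotopic_sym f g : homotopic f g -> homotopic g f.
Proof.
case=> h [hc hv h0 h1]; exists (fun t s => h t (1 - s)); split=> [i w|t s s01|t|t].
- apply: (@continuous_comp_fun _ _ _ (fun x : T * R => (x.1, 1 - x.2))
           (fun x => h x.1 x.2 i w)); last exact: hc.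
  apply: continuous_pair; first exact: continuous_fst.
  by apply: continuous_sub; [exact: continuous_cst|exact: continuous_snd].
- by apply: hv; lra.
- by rewrite subr0 h1.
- by rewrite subrr h0.
Qed.

Lemma homotopic_trans f g k : homotopic f g -> homotopic g k -> homotopic f k.
Proof.
move=> fg; have cg i w := homotopic_continuous1 (i := i) (w := w) fg.
case: fg => h [hc hv h0 h1] [h' [hc' hv' h0' h1']].
(* At every time one of the first two terms cancels the third. *)
exists (fun t s i w => h t (clamp 1 (s + s)) i w
                     + h' t (clamp 1 (s + s - 1)) i w - g t i w).
have c2 : continuous (fun x : T * R => x.2 + x.2).
  by apply: continuous_add; exact: continuous_snd.
split=> [i w|t s s01|t|t].
- apply: continuous_sub; first apply: continuous_add.
  + apply: (@continuous_comp_fun _ _ _ (fun x : T * R =>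
      (x.1, clamp 1 (x.2 + x.2))) (fun x => h x.1 x.2 i w)); last exact: hc.
    apply: continuous_pair; first exact: continuous_fst.
    exact: continuous_clamp.
  + apply: (@continuous_comp_fun _ _ _ (fun x : T * R =>
      (x.1, clamp 1 (x.2 + x.2 - 1))) (fun x => h' x.1 x.2 i w)); last exact: hc'.
    apply: continuous_pair; first exact: continuous_fst.
    apply: continuous_clamp; apply: continuous_sub => //.
    exact: continuous_cst.
  + by apply: (@continuous_comp_fun _ _ _ fst (fun t => g t i w));
      [exact: continuous_fst|exact: cg].
- have [s2|s2] := leP (s + s) 1.
    have -> : (fun i w => h t (clamp 1 (s + s)) i w
                     + h' t (clamp 1 (s + s - 1)) i w - g t i w) = h t (s + s).
      rewrite (@clamp_le0 _ _ (s + s - 1)) ?h0'; last by lra.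
      rewrite clamp_id; last by lra.
      by apply/funext => i; apply/funext => w; lra.
    by apply: hv; lra.
  have -> : (fun i w => h t (clamp 1 (s + s)) i w
        + h' t (clamp 1 (s + s - 1)) i w - g t i w) = h' t (s + s - 1).
    rewrite (@clamp_ge _ _ (s + s)) ?h1; last by lra.
    rewrite clamp_id; last by lra.
    by apply/funext => i; apply/funext => w; lra.
  by apply: hv'; lra.
- rewrite (@clamp_le0 _ _ (0 + 0)) ?h0; last by lra.
  rewrite clamp_le0 ?h0'; last by lra.
  by apply/funext => i; apply/funext => w; lra.
- rewrite (@clamp_ge _ _ (1 + 1)) ?h1; last by lra.
  rewrite clamp_ge ?h1'; last by lra.
  by apply/funext => i; apply/funext => w; lra.
Qed.

End Configurations.

(** * Motion planners from homotopies *)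

Section Local_section.
Variables (R : realType) (V : finType) (e : rel V) (n : nat).
Local Notation F := (configuration_space (realization R e) n).

(** At each pair the homotopy traces a path from the first configuration to the second. Currying
    turns its joint continuity into continuity for the compact-open topology. *)
Lemma homotopic_has_local_section (U : set (F * F)) :
  homotopic e (fun u : set_type U => position (\val u).1)
              (fun u => position (\val u).2) ->
  has_local_section R U.
Proof.
case=> h [hc hv h0 h1].
pose J := unit_interval R.
(* Coordinates determine a configuration, so the one chosen here inherits the continuity of [h]. *)
have hJ (x : set_type U * J) : {z : F | position z = h x.1 (\val x.2)}.
  apply: cid; apply: position_surj; apply: hv.
  by have := set_valP x.2; rewrite /= in_itv.
pose H x := projT1 (hJ x).
have HE x : position (H x) = h x.1 (\val x.2) by rewrite /H; case: (hJ x).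
have cH : continuous H.
  apply: continuous_into_conf => i w.
  have -> : (fun x => position (H x) i w) = (fun x => h x.1 (\val x.2) i w).
    by apply/funext => x; rewrite HE.
  apply: (@continuous_comp_fun _ _ _
    (fun x : set_type U * J => (x.1, \val x.2))
    (fun x => h x.1 x.2 i w)); last exact: hc.
  apply: continuous_pair; first exact: continuous_fst.
  apply: (@continuous_comp_fun _ _ _ snd (fun y : J => \val y)).
    exact: continuous_snd.
  exact: continuous_set_val.
have [cc cp] := continuous_curry cH.
pose s (u : set_type U) : path_space R F :=
  exist _ (curry H u : {compact-open, J -> F}) (mem_set (cp u)).
exists s.
  by apply: continuous_into_set_type; exact: cc.
move=> u; rewrite /endpoints /= /curry [RHS]surjective_pairing.
by congr pair; apply: position_inj; rewrite HE /= ?h0 ?h1.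
Qed.

End Local_section.

(** * Rooted trees *)

(** The root is its own parent, so [p] can be iterated freely. Acyclicity is recorded in the last
    field: every edge joins a vertex to its parent. *)
Record rooted (V : finType) (e : rel V) (o : V) (p : V -> V) (dep : V -> nat)
  : Prop := Rooted {
  parent_root : p o = o;
  depth_root : dep o = 0%N;
  parent_edge : forall v, v != o -> e (p v) v;
  depth_parent : forall v, v != o -> dep v = (dep (p v)).+1;
  edge_parent : forall u v, e u v -> u = p v \/ v = p u }.

Section Rooting.
Local Open Scope nat_scope.
Variables (V : finType) (e : rel V).
Hypothesis tree_e : is_tree e.

(** The depth is the distance from [o], and the parent is the last but one vertex of a shortest
    path. An edge that is not a parent edge would close a path of parent edges to a cycle. *)
Lemma exists_rooted (o : V) : exists p dep, rooted e o p dep.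
Proof.
case: tree_e => esym eirr econn eacyc.
pose P v k := [exists s : k.-tuple V, path e o s && (last o s == v)].
have exP v : exists k, P v k.
  have /connectP[s es ->] := econn o v.
  by exists (size s); apply/existsP; exists (in_tuple s); rewrite es eqxx.
pose dep v := ex_minn (exP v).
have depP v s : path e o s -> last o s = v -> dep v <= size s.
  move=> es lv; rewrite /dep; case: ex_minnP => m _; apply.
  by apply/existsP; exists (in_tuple s); rewrite es lv eqxx.
have depE v : exists2 s, path e o s /\ last o s = v & size s = dep v.
  rewrite /dep; case: ex_minnP => m /existsP[s /andP[es /eqP lv]] _.
  by exists s; rewrite ?size_tuple.
have dep0 : dep o = 0 by apply/eqP; rewrite -leqn0 (depP o [::]).
have parent v : exists u, (v = o -> u = o) /\
    (v <> o -> e u v /\ dep v = (dep u).+1).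
  have [->|vo] := eqVneq v o; first by exists o.
  have [s [es lv] sv] := depE v.
  case: (lastP s) es lv sv => [|s' x]; first by move=> _ /= ov; rewrite ov eqxx in vo.
  rewrite rcons_path last_rcons size_rcons => /andP[es' ex] xv sv.
  move: ex; rewrite xv => ex.
  exists (last o s'); split=> [/eqP|_]; first by rewrite (negbTE vo).
  split=> //; have := depP (last o s') s' es' erefl.
  have [s2 [es2 l2] sz2] := depE (last o s').
  have := depP v (rcons s2 v); rewrite rcons_path es2 l2 ex last_rcons size_rcons.
  by move=> /(_ isT erefl); lia.
have [p pP] := choice parent.
have po : p o = o by exact: (pP o).1.
have pe v : v != o -> e (p v) v by move=> /eqP /(pP v).2 [].
have dp v : v != o -> dep v = (dep (p v)).+1 by move=> /eqP /(pP v).2 [].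
exists p, dep; split=> // u v euv.
pose t := [rel x y | (y != o) && (x == p y) || (x != o) && (y == p x)].
have tsym : symmetric t by move=> x y /=; rewrite orbC.
have te x y : t x y -> e x y.
  by case/orP=> /andP[xo /eqP ->]; [exact: pe|rewrite esym; exact: pe].
have to x : connect t o x.
  have [k] := ubnP (dep x); elim: k x => // k IH x xk.
  have [->|xo] := eqVneq x o; first exact: connect0.
  apply: (@connect_trans _ _ (p x)).
    by apply: IH; move: xk; rewrite (dp x xo).
  by apply: connect1; rewrite /= xo eqxx.
have tuv : connect t v u.
  by apply: (@connect_trans _ _ o); rewrite // (sym_connect_sym tsym).
have {tuv} [s ts us] := connectP tuv.
(* The shortened path closes up with the edge [u v] to a cycle, which has at most two vertices;
   hence the path is a single parent edge. *)
case: (shortenP ts) us => s' ts' us' _ lu.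
have /eacyc sz : ucycle e (v :: s').
  rewrite /ucycle us' andbT /= rcons_path -lu euv andbT.
  by apply: sub_path ts' => x y; exact: te.
case: s' ts' us' lu sz => [|x [|y s']] //= ts' us' lu _.
  by move: euv; rewrite lu eirr.
move: ts'; rewrite -lu andbT => /orP[] /andP[_ /eqP]; first by right.
by left.
Qed.

(* A vertex at maximal distance from another one is a leaf. *)
Lemma exists_leaf : (exists v, essential e v) ->
  exists o c, e o c /\ forall u, e o u -> u = c.
Proof.
case: (tree_e) => esym eirr _ _ [r rE].
have [p [dep H]] := exists_rooted r.
have [y ry] : exists y, e r y.
  have : 0 < #|[pred u | e r u]| by apply: leq_trans rE.
  by case/card_gt0P=> y; exists y.
have yr : y != r by apply: contraTneq ry => ->; rewrite eirr.
have [x _ xmax] := arg_maxnP (i0 := r) (P := predT) dep isT.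
have xr : x != r.
  apply: contraTneq (xmax y isT) => ->.
  by rewrite /= (depth_root H) (depth_parent H yr).
exists x, (p x); split; first by rewrite esym (parent_edge H xr).
(* A neighbour whose parent is [x] would be deeper than [x]. *)
move=> u xu; case: (edge_parent H xu) => // xE.
have ur : u != r.
  by apply: contraTneq xu => ur; rewrite xE ur (parent_root H) eirr.
by have := xmax u isT; rewrite /= (depth_parent H ur) -xE ltnn.
Qed.

End Rooting.

(** * Ancestors and descending chains *)

Section Ancestors.
Local Open Scope nat_scope.
Variables (V : finType) (e : rel V) (o : V) (p : V -> V) (dep : V -> nat).
Hypothesis H : rooted e o p dep.

Lemma depth_parentE v : dep (p v) = (dep v).-1.
Proof.
have [->|vo] := eqVneq v o; first by rewrite (parent_root H) (depth_root H).
by rewrite (depth_parent H vo).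
Qed.

Lemma depth_iter k v : dep (iter k p v) = dep v - k.
Proof. by elim: k => [|k IH] /=; rewrite ?subn0 // depth_parentE IH subnS. Qed.

Lemma depth_eq0 v : (dep v == 0) = (v == o).
Proof.
have [->|vo] := eqVneq v o; first by rewrite (depth_root H) eqxx.
by rewrite (depth_parent H vo).
Qed.

Lemma parent_neq v : v != o -> p v != v.
Proof.
by move=> vo; apply/eqP => E; have := depth_parent H vo; rewrite E; lia.
Qed.

Definition anc u v := (dep u <= dep v) && (iter (dep v - dep u) p v == u).

Lemma anc_depth u v : anc u v -> dep u <= dep v.
Proof. by case/andP. Qed.

Lemma anc_refl v : anc v v.
Proof. by rewrite /anc leqnn subnn eqxx. Qed.

Lemma anc_iter k v : anc (iter k p v) v.
Proof.
rewrite /anc depth_iter leq_subr /=.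
have [kv|/ltnW vk] := leqP k (dep v); first by rewrite subKn.
have iter_o j : iter j p o = o by elim: j => //= j ->; exact: parent_root H.
have -> : iter k p v = iter (k - dep v) p (iter (dep v) p v).
  by rewrite -iterD subnK.
have /eqP -> : iter (dep v) p v == o by rewrite -depth_eq0 depth_iter subnn.
have /eqP -> : dep v - k == 0 by rewrite subn_eq0.
rewrite subn0 iter_o.
by rewrite -depth_eq0 depth_iter subnn.
Qed.

Lemma anc_ex u v : anc u v -> exists k, u = iter k p v.
Proof. by case/andP=> _ /eqP; exists (dep v - dep u). Qed.

Lemma anc_trans u v w : anc u v -> anc v w -> anc u w.
Proof.
by move=> /anc_ex[k ->] /anc_ex[j ->]; rewrite -iterD; exact: anc_iter.
Qed.

Lemma anc_parent v : anc (p v) v.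
Proof. exact: (anc_iter 1). Qed.

Lemma anc_same_depth u v w : anc u w -> anc v w -> dep u = dep v -> u = v.
Proof. by case/andP=> _ /eqP + /andP[_ /eqP +] duv; rewrite duv => -> ->. Qed.

(** The ancestors of [w] form a chain: the ancestor of [v] at the depth of [u] is one of [w] too, so
    it is [u]. *)
Lemma anc_total u v w : anc u w -> anc v w -> dep u <= dep v -> anc u v.
Proof.
move=> uw vw uv; rewrite /anc uv /=; apply/eqP.
apply: (@anc_same_depth _ _ w) => //; first by apply: anc_trans vw; exact: anc_iter.
by rewrite depth_iter subKn.
Qed.

Lemma anc_at_depth k v : k <= dep v -> exists2 u, anc u v & dep u = k.
Proof.
move=> kv; exists (iter (dep v - k) p v); first exact: anc_iter.
by rewrite depth_iter subKn.
Qed.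

Lemma anc_anti u v : anc u v -> anc v u -> u = v.
Proof.
move=> uv vu; apply: (anc_same_depth uv (anc_refl v)).
by apply/eqP; rewrite eqn_leq !anc_depth.
Qed.

Lemma anc_parent_or u v : anc u v -> u = v \/ anc u (p v).
Proof.
case/anc_ex=> -[|k] ->; first by left.
by right; rewrite iterSr; exact: anc_iter.
Qed.

Hypotheses (e_sym : symmetric e) (eirr : irreflexive e).
Variable c : V.
Hypotheses (eoc : e o c) (leaf_o : forall u, e o u -> u = c).

Lemma root_not_essential : ~~ essential e o.
Proof.
rewrite /essential -leqNgt (leq_trans _ (isT : 1 <= 2)) //.
rewrite -(card1 c); apply: subset_leq_card; apply/fintype.subsetP => u.
by rewrite !inE => /leaf_o ->.
Qed.

Definition child v u := (u != o) && (p u == v).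

(** The parent and two distinct children would be three neighbours. The root, being its own parent,
    needs the leaf condition instead. *)
Lemma child_unique v u u' : ~~ essential e v -> child v u -> child v u' -> u = u'.
Proof.
move=> vE /andP[uo /eqP uv] /andP[uo' /eqP uv'].
have [vo|vo] := eqVneq v o.
  have ou : e o u by rewrite -vo -uv; exact: (parent_edge H).
  have ou' : e o u' by rewrite -vo -uv'; exact: (parent_edge H).
  by rewrite (leaf_o ou) (leaf_o ou').
apply/eqP; apply: contraNT vE => uu'; rewrite /essential.
pose s := [:: p v; u; u'].
have us : uniq s.
  rewrite /= !inE negb_or uu' !andbT.
  have dv := depth_parent H vo; have du := depth_parent H uo.
  have du' := depth_parent H uo'; rewrite uv in du; rewrite uv' in du'.
  by apply/andP; split; apply/eqP => E; move: dv; rewrite E; lia.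
rewrite -[3]/(size s) -(card_uniqP us); apply: subset_leq_card; apply/fintype.subsetP => x.
rewrite !inE => /or3P[] /eqP ->.
- by rewrite e_sym; exact: (parent_edge H).
- by rewrite -uv; exact: (parent_edge H).
- by rewrite -uv'; exact: (parent_edge H).
Qed.

(** One step down a chain, made stationary at essential and at childless vertices so that it can be
    iterated past the lower end. *)
Definition next_vertex v :=
  if essential e v then v else odflt v [pick u | child v u].

Lemma next_vertexP v : next_vertex v = v \/ child v (next_vertex v).
Proof.
rewrite /next_vertex; case: ifP => _; first by left.
by case: pickP => [u|] /=; [right|left].
Qed.

Lemma next_vertex_child v u : ~~ essential e v -> child v u -> next_vertex v = u.
Proof.
move=> vE vu; rewrite /next_vertex (negbTE vE); case: pickP => [x vx|/(_ u)] /=.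
  exact: child_unique vx vu.
by rewrite vu.
Qed.

Lemma next_vertex_essential v : essential e v -> next_vertex v = v.
Proof. by rewrite /next_vertex => ->. Qed.

(* The component of the complement of the essential vertices containing the
   open edge above [v] is a descending chain, and [bot v] is its lower end. *)
Definition bot v := iter (\max_u dep u).+1 next_vertex v.

Lemma anc_iter_next k v : anc v (iter k next_vertex v).
Proof.
elim: k => [|k IH] /=; first exact: anc_refl.
case: (next_vertexP (iter k next_vertex v)) => [-> //|/andP[_ /eqP E]].
by apply: (anc_trans IH); rewrite -{1}E; exact: anc_parent.
Qed.

Lemma anc_bot v : anc v (bot v).
Proof. exact: anc_iter_next. Qed.

(** A step that is not stationary increases the depth, so more steps than the maximal depth end at a
    fixed point. *)
Lemma next_vertex_bot v : next_vertex (bot v) = bot v.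
Proof.
have key k : next_vertex (iter k next_vertex v) = iter k next_vertex v \/
    k <= dep (iter k next_vertex v).
  elim: k => [|k IH] /=; first by right.
  case: IH => [E|IH]; first by left; rewrite !E.
  case: (next_vertexP (iter k next_vertex v)) => [E|/andP[no /eqP E]].
    by left; rewrite !E.
  by right; rewrite (depth_parent H no) E.
case: (key (\max_u dep u).+1) => //.
by rewrite ltnNge (leq_bigmax (bot v)).
Qed.

Lemma bot_next_vertex v : bot (next_vertex v) = bot v.
Proof. by rewrite /bot -iterSr iterS; exact: next_vertex_bot. Qed.

Lemma bot_essential v : essential e v -> bot v = v.
Proof.
by move=> vE; rewrite /bot; elim: _.+1 => //= k ->; exact: next_vertex_essential.
Qed.

Lemma bot_child v u : ~~ essential e v -> child v u -> bot u = bot v.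
Proof. by move=> vE vu; rewrite -(next_vertex_child vE vu) bot_next_vertex. Qed.

(** The descent from [v] to [bot v] goes from parent to child, so it passes through [u], and [bot]
    is constant along it. *)
Lemma bot_between u v : anc v u -> anc u (bot v) -> bot u = bot v.
Proof.
rewrite {1}/bot; elim: _.+1 => [|k IH] /= vu.
  by move=> /(anc_anti vu) ->.
case/anc_parent_or => [->|].
  by rewrite bot_next_vertex; elim: k {IH} => //= k IH; rewrite bot_next_vertex.
case: (next_vertexP (iter k next_vertex v)) => [->|/andP[_ /eqP ->]]; last exact: IH.
by move=> up; apply: IH => //; apply: anc_trans up _; exact: anc_parent.
Qed.

End Ancestors.

(** * Points of a rooted tree *)

Section Points.
Variables (R : realType) (V : finType) (e : rel V) (o : V) (p : V -> V).
Variable dep : V -> nat.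
Hypotheses (H : rooted e o p dep) (e_sym : symmetric e) (eirr : irreflexive e).
Implicit Types (x : V -> R) (s t : R).

(** The point at fraction [t] of the way down the edge from [p v] to [v]; for [v = o] it is the root
    for every [t]. *)
Definition edge_point v t w : R := (1 - t) * (w == p v)%:R + t * (w == v)%:R.

(** The linear extension of the vertex depths, that is, the distance to the root. *)
Definition depth x : R := \sum_w (dep w)%:R * x w.

(* Every point is an [edge_point v t] for exactly one pair satisfying this. *)
Definition normal v t := (0 < t <= 1) && ((v == o) ==> (t == 1)).

Lemma edge_point_realization v t : 0 <= t <= 1 ->
  realization_set R e (edge_point v t).
Proof.
move=> t01; split.
- move=> w; rewrite /edge_point.
  by case: (w == p v); case: (w == v); rewrite ?mulr1 ?mulr0; lra.
- rewrite /edge_point big_split /= -!mulr_sumr.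
  have sum1 u : \sum_w (w == u)%:R = 1 :> R.
    by rewrite (bigD1 u) //= eqxx big1 ?addr0 // => w /negbTE ->.
  by rewrite !sum1; lra.
- exists (p v), v; split.
    have [->|vo] := eqVneq v o; first by left; rewrite (parent_root H).
    by right; exact: (parent_edge H).
  by move=> w /negbTE wp /negbTE wv; rewrite /edge_point wp wv !mulr0 addr0.
Qed.

Lemma coordinate_bounds x w : realization_set R e x -> 0 <= x w <= 1.
Proof.
case=> x0 x1 _; rewrite x0 -x1 (bigD1 w) //= lerDl.
by rewrite sumr_ge0.
Qed.

Lemma normal1 v : normal v 1.
Proof. by rewrite /normal ltr01 lexx eqxx implybT. Qed.

Lemma normal01 v t : normal v t -> 0 <= t <= 1.
Proof. by case/andP=> /andP[/ltW -> ->]. Qed.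

Lemma edge_point1 v w : edge_point v 1 w = (w == v)%:R.
Proof. by rewrite /edge_point subrr mul0r add0r mul1r. Qed.

Lemma realization_edge_point x : realization_set R e x ->
  exists v t, normal v t /\ x = edge_point v t.
Proof.
case=> x0 x1 [u [v [uv xuv]]].
have vertex u' : (forall w, w != u' -> x w = 0) -> x = edge_point u' 1.
  move=> xu; apply/funext => w; rewrite edge_point1.
  have [->|/xu //] := eqVneq w u'.
  by move: x1; rewrite (bigD1 u') //= big1 ?addr0.
case: uv => [uv|euv].
  exists u, 1; split; first exact: normal1.
  by apply: vertex => w wu; apply: xuv; rewrite -?uv.
wlog uv : u v xuv euv / u = p v.
  move=> IH; case: (edge_parent H euv) => [|vu]; first exact: IH.
  by apply: (IH v u) => //; [move=> w wv wu; exact: xuv|rewrite e_sym].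
have vu : v != u by apply: contraTneq euv => ->; rewrite eirr.
have vo : v != o.
  by apply: contraNneq vu => vo; rewrite uv vo (parent_root H).
have sxuv : x u + x v = 1.
  rewrite -x1 (bigD1 u) //= (bigD1 v) //= big1 ?addr0 // => w /andP[].
  exact: xuv.
(* The upper end of an edge is not written with parameter 0: it is the lower end of its own edge, or
   the root. *)
have [xv|xv] := eqVneq (x v) 0.
  exists u, 1; split; first exact: normal1.
  by apply: vertex => w wu; have [->//|wv] := eqVneq w v; exact: xuv.
exists v, (x v); split.
  rewrite /normal (negbTE vo) andbT lt_neqAle eq_sym xv x0 -sxuv lerDr.
  exact: x0.
apply/funext => w; rewrite /edge_point -uv.
have [->|wu] := eqVneq w u; first by rewrite eq_sym (negbTE vu) mulr1 mulr0; lra.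
have [->|wv] := eqVneq w v; first by rewrite mulr0 mulr1 add0r.
by rewrite xuv // !mulr0 addr0.
Qed.

Lemma edge_point_gt0 v t w : 0 < edge_point v t w -> w = p v \/ w = v.
Proof.
rewrite /edge_point; have [->|] := eqVneq w (p v); first by left.
by have [->|] := eqVneq w v; [right|rewrite !mulr0 addr0 ltxx].
Qed.

Lemma edge_point_self v t : normal v t -> 0 < edge_point v t v.
Proof.
case/andP=> /andP[t0 _]; rewrite /edge_point eqxx.
have [->|vo] := eqVneq v o; first by rewrite (parent_root H) eqxx => /eqP ->; rewrite !mulr1; lra.
by rewrite [v == p v]eq_sym (negbTE (parent_neq H vo)) mulr0 mulr1 add0r.
Qed.

Lemma depth_edge_point v t : normal v t ->
  depth (edge_point v t) = (dep v)%:R - 1 + t.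
Proof.
move=> /andP[_ vt]; rewrite /depth /edge_point.
have -> : \sum_w (dep w)%:R * ((1 - t) * (w == p v)%:R + t * (w == v)%:R) =
    (1 - t) * (dep (p v))%:R + t * (dep v)%:R.
  under eq_bigr do rewrite mulrDr [_ * ((1 - t) * _)]mulrCA
    [X in _ + X]mulrCA.
  have sum1 u : \sum_w (dep w)%:R * (w == u)%:R = (dep u)%:R :> R.
    rewrite (bigD1 u) //= eqxx mulr1 big1 ?addr0 // => w /negbTE ->.
    by rewrite mulr0.
  by rewrite big_split /= -!mulr_sumr !sum1.
have [vo|vo] := eqVneq v o.
  by move: vt; rewrite vo eqxx => /eqP ->; lra.
by rewrite (depth_parent H vo) -natr1; lra.
Qed.

(** The root and the edges without their upper ends partition the tree; this is the lower end of the
    piece containing [x]. *)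
Definition lower_vertex x : V :=
  xget o [set v | exists t, normal v t /\ x = edge_point v t].

Lemma lower_vertexP x : realization_set R e x ->
  exists t, normal (lower_vertex x) t /\ x = edge_point (lower_vertex x) t.
Proof.
move=> /realization_edge_point[v vP]; rewrite /lower_vertex.
by case: xgetP => [y _ //|/(_ v)].
Qed.

Lemma nat_pred_inj (m k : nat) t t' : 0 < t <= 1 -> 0 < t' <= 1 ->
  m%:R - 1 + t = k%:R - 1 + t' -> m = k.
Proof.
move=> t01 t01' E.
have le (a b : nat) : a%:R < b%:R + 1 :> R -> (a <= b)%N.
  by rewrite natr1 ltr_nat ltnS.
by apply/eqP; rewrite eqn_leq; apply/andP; split; apply: le; lra.
Qed.

(** Both vertices have as depth the ceiling of the depth of the point. As [v] has a positive
    coordinate, it is [v'] or its parent, and the parent is less deep unless it is the root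
    itself. *)
Lemma edge_point_inj v t v' t' : normal v t -> normal v' t' ->
  edge_point v t = edge_point v' t' -> v = v'.
Proof.
move=> nv nv' E; have /andP[t01 _] := nv; have /andP[t01' _] := nv'.
have dE : dep v = dep v'.
  by apply: (nat_pred_inj t01 t01'); rewrite -!depth_edge_point // E.
have := edge_point_self nv; rewrite E => /edge_point_gt0[] // vp.
move: dE; rewrite vp (depth_parentE H).
have [-> _|vo] := eqVneq v' o; first exact: (parent_root H).
by rewrite (depth_parent H vo); lia.
Qed.

Lemma lower_vertex_edge_point v t : normal v t -> lower_vertex (edge_point v t) = v.
Proof.
move=> nv; have [t' [nv' E]] := lower_vertexP (edge_point_realization v (normal01 nv)).
exact: edge_point_inj nv' nv (esym E).
Qed.

(* For [0 <= s <= dep b], the point at depth [s] on the path from the root to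
   [b], written with hat functions so as to be visibly continuous in [s]. *)
Definition ray b s w : R :=
  (anc p dep w b)%:R * Num.max 0 (1 - `|clamp (dep b)%:R s - (dep w)%:R|).

Lemma continuous_ray (T : topologicalType) b (f : T -> R) w :
  continuous f -> continuous (fun u => ray b (f u) w).
Proof.
move=> cf; apply: continuous_mul; first exact: continuous_cst.
apply: continuous_maxr; first exact: continuous_cst.
apply: continuous_sub; first exact: continuous_cst.
apply: continuous_absr; apply: continuous_sub; last exact: continuous_cst.
exact: continuous_clamp.
Qed.

Lemma continuous_depth (T : topologicalType) (f : T -> V -> R) :
  (forall w, continuous (f ^~ w)) -> continuous (fun u => depth (f u)).
Proof.
move=> cf; apply: continuous_bigsum => w.
by apply: continuous_mul; [exact: continuous_cst|exact: cf].
Qed.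

Lemma normal_depth_bounds v t b : normal v t -> anc p dep v b ->
  0 <= (dep v)%:R - 1 + t <= (dep b)%:R.
Proof.
move=> /andP[t01 vt] /anc_depth; rewrite -(ler_nat R) => vb.
have [vo|vo] := eqVneq v o.
  move: vt; rewrite vo eqxx (depth_root H) => /eqP ->.
  by have := ler0n R (dep b); lra.
by move: vb; rewrite (depth_parent H vo) -natr1; have := ler0n R (dep (p v)); lra.
Qed.

Lemma hat_far (m k : nat) t : 0 <= t <= 1 -> (m != k)%N -> (m.+1 != k)%N ->
  Num.max 0 (1 - `|m%:R + t - k%:R|) = 0 :> R.
Proof.
move=> t01 mk m1k; apply/max_idPl.
have [km|mk'] := ltnP k m.
  have : k.+1%:R <= m%:R :> R by rewrite ler_nat.
  by rewrite -natr1 => km'; rewrite ger0_norm; lra.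
have : m.+2%:R <= k%:R :> R by rewrite ler_nat; lia.
by rewrite -[m.+2%:R]natr1 -[m.+1%:R]natr1 => km'; rewrite ler0_norm; lra.
Qed.

(** Ancestors of [b] have distinct depths, so at this depth only the hats of the two ends of the
    edge can be nonzero. *)
Lemma ray_edge_point v t b : normal v t -> anc p dep v b ->
  ray b ((dep v)%:R - 1 + t) = edge_point v t.
Proof.
move=> nv vb; have /andP[t01 vt] := nv.
apply/funext => w; rewrite /ray clamp_id ?normal_depth_bounds //.
have [vo|vo] := eqVneq v o.
  move: vt; rewrite vo eqxx => /eqP ->; rewrite edge_point1 (depth_root H).
  have [->|wo] := eqVneq w o.
    rewrite -vo vb vo (depth_root H) [X in `|X|](_ : _ = 0); last by lra.
    by rewrite normr0 subr0 max_r ?mulr1.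
  have : 1 <= (dep w)%:R :> R.
    by rewrite ler1n (depth_parent H wo).
  move=> dw; rewrite [X in _ * X](_ : _ = 0) ?mulr0 //.
  by apply/max_idPl; rewrite ler0_norm; lra.
have dv := depth_parent H vo.
have dvE : (dep v)%:R - 1 + t = (dep (p v))%:R + t by rewrite dv -natr1; lra.
rewrite dvE /edge_point; have pvb := anc_trans H (anc_parent H v) vb.
have [wv|wv] := eqVneq w v.
  rewrite wv vb [v == p v]eq_sym (negbTE (parent_neq H vo)) dv -natr1.
  by rewrite mul1r mulr0 mulr1 add0r ler0_norm ?max_r; lra.
have [wp|wp] := eqVneq w (p v).
  by rewrite wp pvb mul1r mulr1 mulr0 addr0 ger0_norm ?max_r; lra.
case wb : (anc p dep w b); last by rewrite !mulr0 mul0r addr0.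
rewrite hat_far ?mulr0 ?addr0 //; first by lra.
  by apply: contraNneq wp => E; apply/eqP; apply: (anc_same_depth wb pvb).
by apply: contraNneq wv => E; apply/eqP; apply: (anc_same_depth wb vb); rewrite dv.
Qed.

Lemma ray_normal b s : 0 <= s <= (dep b)%:R ->
  exists v t, [/\ anc p dep v b, normal v t, s = (dep v)%:R - 1 + t &
                  ray b s = edge_point v t].
Proof.
move=> /andP[s0 sb].
(* The vertex sought is the ancestor of [b] whose depth is the ceiling of [s]. *)
have : exists k, s <= k%:R by exists (dep b).
move=> /ex_minnP[k sk kmin].
have [v vb dv] := anc_at_depth H (kmin _ sb).
suff [t [nv sE]] : exists t, normal v t /\ s = (dep v)%:R - 1 + t.
  by exists v, t; split=> //; rewrite sE ray_edge_point.
case: k sk kmin dv => [|k] sk kmin dv.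
  by exists 1; split; [exact: normal1|rewrite dv; lra].
have ks : k%:R < s by rewrite ltNge; apply/negP => /kmin; rewrite ltnn.
exists (s - k%:R); split; last by rewrite dv -natr1; lra.
rewrite -natr1 in sk.
have vo : v != o by rewrite -(depth_eq0 H) dv.
by rewrite /normal (negbTE vo) andbT; lra.
Qed.

Lemma ray_clamp b s : ray b (clamp (dep b)%:R s) = ray b s.
Proof.
apply/funext => w; rewrite /ray [clamp _ (clamp _ _)]clamp_id //.
by apply: clamp_bounds; exact: ler0n.
Qed.

Lemma ray_realization b s : realization_set R e (ray b s).
Proof.
rewrite -ray_clamp.
have /ray_normal[v [t [_ nv _ ->]]] := clamp_bounds s (ler0n R (dep b)).
exact: edge_point_realization (normal01 nv).
Qed.

Lemma depth_ray b s : 0 <= s <= (dep b)%:R -> depth (ray b s) = s.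
Proof.
move=> /ray_normal[v [t [_ nv sE rE]]].
by rewrite rE sE; exact: depth_edge_point.
Qed.

Lemma ray_depth x b : realization_set R e x ->
  anc p dep (lower_vertex x) b -> ray b (depth x) = x.
Proof.
move=> /lower_vertexP[t [nv xE]] vb; rewrite [in depth x]xE.
by rewrite depth_edge_point // ray_edge_point.
Qed.

Lemma depth_bounds x b : realization_set R e x ->
  anc p dep (lower_vertex x) b -> 0 <= depth x <= (dep b)%:R.
Proof.
move=> /lower_vertexP[t [nv xE]] vb; rewrite [in depth x]xE.
by rewrite depth_edge_point // normal_depth_bounds.
Qed.

Variable c : V.
Hypotheses (eoc : e o c) (leaf_o : forall u, e o u -> u = c).

Definition at_essential x := [exists v, essential e v && (x v == 1)].

(** The piece of the tree containing [x]: an essential vertex or a component of their complement.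
    The boolean separates an essential vertex from the arc just above it, which has the same
    [bot]. *)
Definition label x := (at_essential x, bot e o p dep (lower_vertex x)).

Lemma label_ray x : realization_set R e x -> ray (label x).2 (depth x) = x.
Proof. by move=> xR; apply: ray_depth => //; exact: anc_bot. Qed.

Lemma realization_vertex x v : realization_set R e x -> x v = 1 ->
  x = edge_point v 1.
Proof.
move=> [x0 x1 _] xv; apply/funext => w; rewrite edge_point1.
have [->//|wv] := eqVneq w v; apply/eqP; rewrite eq_le x0 andbT.
move: x1; rewrite (bigD1 v) //= (bigD1 w) //= xv.
have : 0 <= \sum_(i | (i != v) && (i != w)) x i by rewrite sumr_ge0.
lra.
Qed.

Lemma at_essentialP x : realization_set R e x -> at_essential x ->
  exists2 v, essential e v & x = edge_point v 1.
Proof.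
move=> xR /existsP[v /andP[vE /eqP xv]]; exists v => //.
exact: realization_vertex.
Qed.

Lemma label_essential v : essential e v -> label (edge_point v 1) = (true, v).
Proof.
move=> vE; rewrite /label (lower_vertex_edge_point (normal1 v)).
rewrite bot_essential //; congr pair; apply/existsP; exists v.
by rewrite vE edge_point1 eqxx /=.
Qed.

Lemma label_between x x' d : realization_set R e x -> realization_set R e x' ->
  label x = label x' -> depth x <= d <= depth x' ->
  label (ray (label x).2 d) = label x.
Proof.
move=> xR xR' lxx' /andP[xd dx'].
(* At an essential vertex both points coincide and [d] is their depth. *)
have [xE|xE] := boolP (at_essential x).
  have [v vE xv] := at_essentialP xR xE.
  have xE' : at_essential x' by have [<-] := lxx'.
  have [v' vE' xv'] := at_essentialP xR' xE'.
  move: lxx'; rewrite xv xv' !label_essential // => -[vv']; subst v'.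
  have -> : d = depth x by apply/eqP; rewrite eq_le xd andbT xv -xv'.
  by rewrite xv -{1}[v]/((true, v).2) -(label_essential vE) label_ray -?xv.
have := depth_bounds xR' (anc_bot H (lower_vertex x')).
rewrite -[bot _ _ _ _ _]/(label x').2 -lxx' => /andP[_ x'b].
have x0b := depth_bounds xR (anc_bot H (lower_vertex x)).
have /ray_normal[v [t [vb nv dE ->]]] : 0 <= d <= (dep (label x).2)%:R by lra.
rewrite {1}/label (lower_vertex_edge_point nv).
have [tx [nx xt]] := lower_vertexP xR.
have xv : anc p dep (lower_vertex x) v.
  apply: (anc_total H (anc_bot H _) vb).
  rewrite -ltnS -(ltr_nat R) -natr1; move: xd; rewrite {1}xt depth_edge_point // dE.
  by move: nx nv => /andP[/andP[tx0 _] _] /andP[/andP[_ t1] _]; lra.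
have bv := bot_between H xv vb; rewrite bv /label (negbTE xE); congr pair.
(* An essential vertex reached here would be the lower end of the arc. Since [x'] is at least as
   deep, it would be there too, against the common label. *)
case vE : (at_essential _) => //.
have [u uE uvt] := at_essentialP (edge_point_realization v (normal01 nv)) vE.
have vu := edge_point_inj nv (normal1 u) uvt.
have ub : u = (label x).2 by rewrite /label /= -bv vu bot_essential.
have du : d = (dep u)%:R.
  by rewrite dE -(depth_edge_point nv) uvt (depth_edge_point (normal1 u)); lra.
have x'u : depth x' = (dep u)%:R - 1 + 1.
  by move: x'b; rewrite -ub; lra.
have x'E : x' = edge_point u 1.
  rewrite -(label_ray xR') -lxx' -ub x'u.
  by rewrite ray_edge_point ?normal1 ?anc_refl.
case/negP: xE; change (is_true (label x).1).
by rewrite lxx' x'E label_essential.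
Qed.

Lemma loc_const_at_essential (T : topologicalType) (f : T -> V -> R) u :
  (forall w, continuous (f ^~ w)) -> (forall u, realization_set R e (f u)) ->
  ~~ at_essential (f u) -> \forall u' \near u, ~~ at_essential (f u').
Proof.
move=> cf fR; rewrite negb_exists => /forallP ne.
have lt1 v : essential e v -> f u v < 1.
  move=> vE; have := ne v; rewrite vE /= => n1; rewrite lt_neqAle n1 /=.
  by case/andP: (coordinate_bounds v (fR u)).
have : \forall u' \near u, forall v, essential e v -> f u' v < 1.
  apply: filter_forall => v; have [vE|vE] := boolP (essential e v).
    have := open_pred_lt (cf v) (@continuous_cst T _ (1 : R)) (lt1 v vE).
    by apply: filterS => u' h _; exact: h.
  by apply: nearW.
apply: filterS => u' lt; rewrite negb_exists; apply/forallP => v.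
by rewrite negb_and -implybE; apply/implyP => /lt; rewrite lt_neqAle => /andP[].
Qed.

(** Coordinates positive at [u] stay positive nearby, which restricts the edges that nearby points
    can lie on. *)
Lemma loc_const_label (T : topologicalType) (f : T -> V -> R) u :
  (forall w, continuous (f ^~ w)) -> (forall u, realization_set R e (f u)) ->
  ~~ at_essential (f u) -> \forall u' \near u, label (f u') = label (f u).
Proof.
move=> cf fR fuE; have [t [nv fuv]] := lower_vertexP (fR u).
set v := lower_vertex (f u) in nv fuv.
have pos w : 0 < f u w -> \forall u' \near u, 0 < f u' w.
  exact: (open_pred_lt (@continuous_cst T _ (0 : R)) (cf w)) u.
have key : \forall u' \near u, bot e o p dep (lower_vertex (f u'))
                             = bot e o p dep v.
  have /pos fv : 0 < f u v by rewrite fuv edge_point_self.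
  have lowv u' : 0 < f u' v -> lower_vertex (f u') = v \/
      child o p v (lower_vertex (f u')).
    move=> f0; have [t' [nv' fu']] := lower_vertexP (fR u').
    have [->|nev] := eqVneq (lower_vertex (f u')) v; first by left.
    right; move: f0; rewrite {1}fu' => /edge_point_gt0[vp|/eqP]; last first.
      by rewrite eq_sym (negbTE nev).
    rewrite /child -vp eqxx andbT; apply: contra nev => /eqP E.
    by rewrite vp E (parent_root H).
  (* At a vertex, which is not essential, nearby points have lower vertex [v] or its child, and
     these share [bot]. Inside an edge both ends keep positive coordinates, which excludes a
     child. *)
  have [t1|t1] := eqVneq t 1.
    have vE : ~~ essential e v.
      apply: contra fuE => vE; apply/existsP; exists v.
      by rewrite vE fuv t1 edge_point1 eqxx /=.
    apply: filterS fv => u' /lowv[-> //|vu'].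
    exact: (bot_child H e_sym eoc leaf_o vE vu').
  have vo : v != o by apply: contra t1 => vo; move: nv; rewrite /normal vo => /andP[_].
  have /pos fpv : 0 < f u (p v).
    rewrite fuv /edge_point eqxx (negbTE (parent_neq H vo)) mulr1 mulr0 addr0.
    by move: nv => /andP[/andP[_]]; rewrite le_eqVlt (negbTE t1) subr_gt0.
  apply: filterS2 fv fpv => u' /lowv[-> //|/andP[lo /eqP lv]].
  have [t' [_ fu']] := lower_vertexP (fR u').
  rewrite {1}fu' => /edge_point_gt0[]; rewrite ?lv => pv.
    by have := parent_neq H vo; rewrite {1}pv eqxx.
  have := depth_parent H lo; rewrite lv -pv.
  by have := depth_parent H vo; lia.
apply: filterS2 key (loc_const_at_essential cf fR fuE) => u' bu' eu'.
by rewrite /label bu' (negbTE eu') (negbTE fuE).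
Qed.

End Points.

(** * Path-connectedness of the configuration space *)

Section Connectedness.
Variables (R : realType) (V : finType) (e : rel V) (o : V) (p : V -> V).
Variables (dep : V -> nat) (c : V).
Hypotheses (H : rooted e o p dep) (e_sym : symmetric e) (eirr : irreflexive e).
Hypotheses (eoc : e o c) (leaf_o : forall u, e o u -> u = c).

Local Notation point v t := (@edge_point R V p v t).
Local Notation ray := (@ray R V p dep).
Local Notation depth := (@depth R V dep).

(** A path is a homotopy over a dummy parameter space, so concatenation and reversal are already
    available. *)
Definition path_connected n (z z' : 'I_n -> V -> R) :=
  homotopic e (fun _ : R => z) (fun _ : R => z').

Lemma path_intro n (g : R -> 'I_n -> V -> R) :
  (forall i w, continuous (fun s => g s i w)) ->
  (forall s, 0 <= s <= 1 -> is_conf e (g s)) -> path_connected (g 0) (g 1).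
Proof.
move=> gc gv; exists (fun _ => g); split=> // i w.
exact: (continuous_comp_fun (@continuous_snd R R) (gc i w)).
Qed.

Lemma path_elim n (z z' : 'I_n -> V -> R) : path_connected z z' ->
  exists g : R -> 'I_n -> V -> R,
    [/\ forall i w, continuous (fun s => g s i w),
        forall s, 0 <= s <= 1 -> is_conf e (g s), g 0 = z & g 1 = z'].
Proof.
case=> h [hc hv h0 h1]; exists (h 0); split=> [i w|s||]; [|exact: hv|exact: h0|exact: h1].
apply: (@continuous_comp_fun _ _ _ (fun s : R => ((0 : R), s))
         (fun x => h x.1 x.2 i w)); last exact: hc.
by apply: continuous_pair; [exact: continuous_cst|move=> s; exact: cvg_id].
Qed.

Lemma path_refl n (z : 'I_n -> V -> R) : is_conf e z -> path_connected z z.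
Proof.
by move=> zc; apply: homotopic_refl => // i w; exact: continuous_cst.
Qed.

(** The elementary move from which [path_to_root] and [path_swap] are built. *)
Lemma move_one n (z : 'I_n -> V -> R) k b d0 d1 : is_conf e z ->
  z k = ray b d0 ->
  (forall d j, d0 <= d <= d1 \/ d1 <= d <= d0 -> j != k -> ray b d <> z j) ->
  path_connected z (fun j => if j == k then ray b d1 else z j).
Proof.
move=> [zR zI] zk away.
pose g s j := if j == k then ray b ((1 - s) * d0 + s * d1) else z j.
have g0 : g 0 = z.
  apply/funext => j; rewrite /g; have [->|//] := eqVneq j k.
  by rewrite zk subr0 mul1r mul0r addr0.
have g1 : g 1 = (fun j => if j == k then ray b d1 else z j).
  by apply/funext => j; rewrite /g subrr mul0r mul1r add0r.
rewrite -g1 -g0; apply: path_intro => [i w|s s01].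
  rewrite /g; case: (i == k); last exact: continuous_cst.
  have cid : continuous (fun s : R => s) by move=> s; exact: cvg_id.
  apply: continuous_ray; apply: continuous_add; apply: continuous_mul => //;
    try exact: continuous_cst.
  by apply: continuous_sub => //; exact: continuous_cst.
have between : d0 <= (1 - s) * d0 + s * d1 <= d1 \/
               d1 <= (1 - s) * d0 + s * d1 <= d0.
  by case: (leP d0 d1) => dd; [left|right]; apply/andP; split; nra.
rewrite /g; split=> [i|i j ij].
  by case: eqP => _; [exact: (ray_realization H)|exact: zR].
have [ik|ik] := eqVneq i k; have [jk|jk] := eqVneq j k.
- by rewrite ik jk eqxx in ij.
- exact: away.
- by move/esym; exact: away.
- exact: zI.
Qed.

Lemma ray0 b : ray b 0 = point o 1.
Proof.
have ob : anc p dep o b.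
  by have [u ub /eqP] := anc_at_depth H (leq0n (dep b)); rewrite (depth_eq0 H) => /eqP <-.
rewrite -(ray_edge_point H (normal1 _ o o) ob) (depth_root H).
by congr ray; lra.
Qed.

(** A particle of least depth meets no other on its way up. *)
Lemma path_to_root n (z : 'I_n -> V -> R) (k0 : 'I_n) : is_conf e z ->
  exists k z', z' k = point o 1 /\ path_connected z z'.
Proof.
move=> zc; have [zR _] := zc.
have [k _ kmin] := Order.TotalTheory.arg_minP (i0 := k0) (P := predT)
  (fun i => depth (z i)) isT.
exists k, (fun j => if j == k then ray (lower_vertex o p (z k)) 0 else z j).
rewrite eqxx ray0; split=> //; rewrite -(ray0 (lower_vertex o p (z k))).
apply: (@move_one _ _ _ _ (depth (z k))) => //.
  by rewrite (ray_depth H e_sym eirr) ?anc_refl.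
move=> d j dd jk.
have db := depth_bounds H e_sym eirr (zR k) (anc_refl p dep _).
have {dd} dd : 0 <= d <= depth (z k) by case: dd; lra.
have dj := kmin j isT.
have [->|dk] := eqVneq d (depth (z k)).
  by rewrite (ray_depth H e_sym eirr) ?anc_refl //; apply: (proj2 zc); rewrite eq_sym.
move=> rz; move: dj; rewrite /= -rz (depth_ray H); last by lra.
by move: dk dd; rewrite neq_lt; lra.
Qed.

Lemma root_neq_leaf_end : o != c.
Proof. by apply: contraTneq eoc => <-; rewrite eirr. Qed.

Lemma parent_leaf_end : p c = o.
Proof.
case: (edge_parent H eoc) => // co.
by have := root_neq_leaf_end; rewrite co (parent_root H) eqxx.
Qed.

(** Transfers the fraction [s / 2] of the coordinate at the leaf to its neighbour [c]. This shrinks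
    the leaf edge towards [c] and fixes the rest; the fraction stays below one, so the map is
    injective. *)
Definition push s (x : V -> R) (w : V) : R :=
  x w + s / 2 * x o * ((w == c)%:R - (w == o)%:R).

Lemma push_root s x : push s x o = (1 - s / 2) * x o.
Proof. by rewrite /push eqxx (negbTE root_neq_leaf_end) /=; lra. Qed.

Lemma push_inj s x y : 0 <= s <= 1 -> push s x = push s y -> x = y.
Proof.
move=> s01 xy.
have xyo : x o = y o.
  have := congr1 (fun f => f o) xy; rewrite /= !push_root => /mulfI; apply.
  by apply/eqP; lra.
apply/funext => w; have := congr1 (fun f => f w) xy.
by rewrite /push xyo => /addIr.
Qed.

Lemma push0 x : push 0 x = x.
Proof. by apply/funext => w; rewrite /push !mul0r addr0. Qed.

Lemma push_realization s x : 0 <= s <= 1 ->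
  realization_set R e x -> realization_set R e (push s x).
Proof.
move=> s01 xR; have [v [t [nv xE]]] := realization_edge_point H e_sym eirr xR.
(* On the leaf edge, the root included as [t' = 0], [push] acts on the parameter; elsewhere the
   coordinate at [o] vanishes. *)
have pushc t' : 0 <= t' <= 1 -> x = point c t' ->
    realization_set R e (push s x).
  move=> t01 ->.
  have -> : push s (point c t') = point c (t' + s / 2 * (1 - t')).
    apply/funext => w; rewrite /push /edge_point parent_leaf_end eqxx.
    by rewrite (negbTE root_neq_leaf_end) /=; ring.
  by apply: (edge_point_realization H) => //; nra.
have [vo|vo] := eqVneq v o.
  apply: (pushc 0); first by rewrite lexx ler01.
  move: nv; rewrite /normal vo eqxx => /andP[_ /eqP t1].
  rewrite xE vo t1; apply/funext => w.
  by rewrite /edge_point parent_leaf_end (parent_root H); lra.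
have [vc|vc] := eqVneq v c.
  by apply: (pushc t); rewrite -?vc // (normal01 nv).
have pvo : o != p v.
  apply: contra vc => /eqP ov; apply/eqP; apply: leaf_o; rewrite ov.
  exact: (parent_edge H).
have xo : x o = 0.
  by rewrite xE /edge_point (negbTE pvo) eq_sym (negbTE vo) !mulr0 addr0.
by have -> : push s x = x by apply/funext => w; rewrite /push xo mulr0 mul0r addr0.
Qed.

Lemma continuous_push (T : topologicalType) (f : T -> R) (x : T -> V -> R) w :
  continuous f -> (forall w, continuous (x ^~ w)) ->
  continuous (fun u => push (f u) (x u) w).
Proof.
move=> cf cx; apply: continuous_add => //.
apply: continuous_mul; last exact: continuous_cst.
by apply: continuous_mul => //; apply: continuous_mul => //; exact: continuous_cst.
Qed.

Section Root_occupied.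
Variables (n : nat) (k : 'I_n.+1).

Definition add_root (y : 'I_n -> V -> R) (i : 'I_n.+1) : V -> R :=
  if unlift k i is Some j then y j else point o 1.

(** The leaf is free for the new particle either because [push] has cleared it or because no other
    particle was there. *)
Lemma add_root_conf s (y : 'I_n -> V -> R) : 0 <= s <= 1 -> is_conf e y ->
  0 < s \/ (forall j, y j o < 1) -> is_conf e (add_root (fun j => push s (y j))).
Proof.
move=> s01 [yR yI] away.
have lt1 j : push s (y j) o < 1.
  have yo := coordinate_bounds o (yR j).
  rewrite push_root; case: away => [s0|/(_ j) yj]; nra.
have po : point o 1 o = 1 by rewrite edge_point1 eqxx.
split=> [i|i i' ii']; rewrite /add_root.
  case: unliftP => [j _|_]; first exact: push_realization.
  by apply: (edge_point_realization H) => //; rewrite ler01 lexx.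
case: (unliftP k i) => [j iE|iE]; case: (unliftP k i') => [j' iE'|iE'] E.
- have {E} := push_inj s01 E; apply: yI; apply: contra ii' => /eqP jj'.
  by rewrite iE iE' jj'.
- by have := lt1 j; rewrite E po ltxx.
- by have := lt1 j'; rewrite -E po ltxx.
- by rewrite iE iE' eqxx in ii'.
Qed.

Hypothesis IH : forall y y' : 'I_n -> V -> R,
  is_conf e y -> is_conf e y' -> path_connected y y'.

(** The other particles are first pushed off the leaf. They then follow the path given by induction
    composed with [push 1], as that path itself may visit the leaf. *)
Lemma path_root_occupied (z z' : 'I_n.+1 -> V -> R) :
  is_conf e z -> is_conf e z' -> z k = point o 1 -> z' k = point o 1 ->
  path_connected z z'.
Proof.
have rest (x : 'I_n.+1 -> V -> R) : is_conf e x -> x k = point o 1 ->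
    is_conf e (fun j => x (lift k j)) /\
    path_connected x (add_root (fun j => push 1 (x (lift k j)))).
  move=> [xR xI] xk.
  have yc : is_conf e (fun j => x (lift k j)).
    split=> [j|j j' jj']; first exact: xR.
    by apply: xI; apply: contra jj' => /eqP /lift_inj ->.
  split=> //; pose g s := add_root (fun j => push s (x (lift k j))).
  have g0 : g 0 = x.
    apply/funext => i; rewrite /g /add_root.
    by case: unliftP => [j ->|->//]; rewrite push0.
  rewrite -{1}g0; apply: (@path_intro _ g) => [i w|s s01].
    rewrite /g /add_root; case: unliftP => [j _|_]; last exact: continuous_cst.
    apply: continuous_push; first by move=> s; exact: cvg_id.
    by move=> w'; exact: continuous_cst.
  apply: add_root_conf => //; right=> j.
  have [x0 x1 _] := xR (lift k j); rewrite lt_neqAle; apply/andP; split.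
    apply/negP => /eqP /(realization_vertex p (xR _)).
    by rewrite -xk; apply: xI; rewrite eq_sym neq_lift.
  by rewrite -x1 (bigD1 o) //= lerDl sumr_ge0.
move=> zc z'c zk z'k.
have [yc zy] := rest z zc zk; have [y'c zy'] := rest z' z'c z'k.
apply: (homotopic_trans zy); apply: homotopic_trans (homotopic_sym zy').
have [g [gc gv g0 g1]] := path_elim (IH yc y'c).
pose h s := add_root (fun j => push 1 (g s j)).
have -> : add_root (fun j => push 1 (z (lift k j))) = h 0 by rewrite /h g0.
have -> : add_root (fun j => push 1 (z' (lift k j))) = h 1 by rewrite /h g1.
apply: path_intro => [i w|s s01].
  rewrite /h /add_root; case: unliftP => [j _|_]; last exact: continuous_cst.
  by apply: continuous_push; [exact: continuous_cst|exact: gc].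
by apply: add_root_conf; [rewrite ler01 lexx|exact: gv|left; exact: ltr01].
Qed.

End Root_occupied.

Lemma two_children r : essential e r ->
  exists a b, [/\ a != b, child o p r a & child o p r b].
Proof.
move=> rE.
have ro : r != o.
  by apply: contraTneq rE => ->; exact: (root_not_essential leaf_o).
have : (1 < #|[pred u | e r u & u != p r]|)%N.
  move: rE; rewrite /essential (cardD1 (p r)) inE.
  have -> : #|[predD1 [pred u | e r u] & p r]| = #|[pred u | e r u & u != p r]|.
    by apply: eq_card => u; rewrite !inE andbC.
  by case: (e r (p r)); rewrite ?add0n ?add1n //; exact: ltnW.
have ch u : u \in [pred u | e r u & u != p r] -> child o p r u.
  rewrite !inE => /andP[ru up]; case: (edge_parent H ru) => [rpu|uE].
    rewrite /child -rpu eqxx andbT; apply: contra ro => /eqP uo.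
    by rewrite rpu uo (parent_root H).
  by rewrite uE eqxx in up.
by case/card_gt1P => a [b [/ch ra /ch rb ab]]; exists a, b.
Qed.

(* Particle [k] starts at the leaf, [k'] in the middle of the edge above [a]
   and the others below it on the same edge. Then [k] goes to [b], out of the
   way, and [k'] goes to the leaf. *)
Lemma path_swap (n : nat) (k k' : 'I_n) : k != k' ->
  (exists r, essential e r) ->
  exists z z' : 'I_n -> V -> R,
    [/\ z k = point o 1, z' k' = point o 1 & path_connected z z'].
Proof.
move=> kk' [r /two_children[a [b [ab /andP[ao /eqP pa] /andP[bo /eqP pb]]]]].
have da : dep a = dep b by rewrite (depth_parent H ao) (depth_parent H bo) pa pb.
(* The values [1 - 1/(j+3)] are distinct and at least 2/3, so these particles lie strictly below the
   middle of the edge and above [a]. *)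
pose t (j : 'I_n) : R := if j == k' then 2^-1 else 1 - (j.+3%:R)^-1.
have tk' : t k' = 2^-1 by rewrite /t eqxx.
have tbig j : j != k' -> 2^-1 < t j < 1.
  rewrite /t => /negbTE ->.
  have : 0 < j.+3%:R^-1 :> R by rewrite invr_gt0 ltr0n.
  have : 3 * j.+3%:R^-1 <= 1 :> R.
    by rewrite ler_pdivrMr ?mul1r // ?ltr0n // ler_nat.
  by move: (_^-1) => y; lra.
have t01 j : 0 < t j <= 1.
  by have [->|/tbig] := eqVneq j k'; [rewrite tk'|]; lra.
have na j : normal o a (t j) by rewrite /normal t01 (negbTE ao).
have pt_a j : point a (t j) a = t j.
  by rewrite /edge_point eqxx [a == _]eq_sym (negbTE (parent_neq H ao)) /=; lra.
have t_inj i j : t i = t j -> i = j.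
  have [->|ik] := eqVneq i k'; have [->|jk] := eqVneq j k' => //.
  - by have /andP[+ _] := tbig j jk; rewrite tk' => + E; rewrite -E ltxx.
  - by have /andP[+ _] := tbig i ik; rewrite tk' => + E; rewrite E ltxx.
  rewrite /t (negbTE ik) (negbTE jk) => /addrI/oppr_inj/invr_inj/eqP.
  by rewrite eqr_nat !eqSS => /eqP /val_inj.
have not_anc u v : u != v -> dep u = dep v -> anc p dep u v = false.
  move=> uv duv; apply/negP => uav; case/eqP: uv.
  exact: (anc_same_depth uav (anc_refl p dep v)).
pose z j := if j == k then ray b 0 else point a (t j).
(* Neither of [a] and [b] is above the other, so the coordinate at [a] vanishes along the ray to
   [b], while it is positive at all the points chosen above [a]. *)
have ray_ba d : ray b d a = 0 by rewrite /ray not_anc // mul0r.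
have ray_ab d : ray a d b = 0 by rewrite /ray not_anc ?mul0r // eq_sym.
have away_b d j : ray b d <> point a (t j).
  by move=> E; have := t01 j; rewrite -pt_a -E ray_ba ltxx.
have zc : is_conf e z.
  split=> [i|i j ij]; rewrite /z.
    case: eqP => _; first exact: (ray_realization H).
    exact: (edge_point_realization H _ (normal01 (na i))).
  have [ik|ik] := eqVneq i k; have [jk|jk] := eqVneq j k.
  - by rewrite ik jk eqxx in ij.
  - exact: away_b.
  - by move/esym; exact: away_b.
  - move=> E; case/eqP: ij; apply: t_inj.
    by rewrite -pt_a E pt_a.
have step1 := @move_one _ z k b 0 (dep b)%:R zc.
have {}step1 : path_connected z
    (fun j => if j == k then ray b (dep b)%:R else z j).
  apply: step1; first by rewrite /z eqxx.
  by move=> d j _ jk; rewrite /z (negbTE jk); exact: away_b.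
set z1 := (X in path_connected z X) in step1.
have z1k' : z1 k' = ray a ((dep a)%:R - 1 + 2^-1).
  rewrite /z1 /z eq_sym (negbTE kk').
  by rewrite -tk' (ray_edge_point H (na k') (anc_refl p dep a)).
have z1c : is_conf e z1 := homotopic_conf1 0 step1.
have d1 : 1 <= (dep a)%:R :> R by rewrite ler1n (depth_parent H ao).
have step2 := @move_one _ z1 k' a _ 0 z1c z1k'.
exists z, (fun j => if j == k' then ray a 0 else z1 j).
rewrite {1}/z !eqxx !ray0; split=> //.
apply: (homotopic_trans step1); rewrite -(ray0 a); apply: step2.
move=> d j dd jk'.
have {dd} dd : 0 <= d <= (dep a)%:R - 1 + 2^-1 by case: dd; lra.
have [->|jk] := eqVneq j k.
  move=> E; have := ray_ab d; rewrite E /z1 eqxx.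
  have -> : ray b (dep b)%:R = point b 1.
    rewrite -(ray_edge_point H (normal1 _ o b) (anc_refl p dep b)).
    by congr ray; lra.
  by rewrite edge_point1 eqxx => /eqP; rewrite oner_eq0.
(* The remaining particles are deeper than the starting point of [k']. *)
rewrite /z1 /z (negbTE jk) => E.
have := depth_edge_point H (na j); rewrite -E (depth_ray H); last by lra.
by have := tbig j jk'; lra.
Qed.

Lemma configurations_connected : (exists r, essential e r) ->
  forall n (z z' : 'I_n -> V -> R),
  is_conf e z -> is_conf e z' -> path_connected z z'.
Proof.
move=> ess; elim=> [|n IH] z z' zc z'c.
  (* Without particles there is only one configuration. *)
  have -> : z' = z by apply/funext => -[].
  exact: path_refl.
have [k [y [yk zy]]] := path_to_root ord0 zc.
have [k' [y' [y'k' zy']]] := path_to_root ord0 z'c.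
have yc : is_conf e y := homotopic_conf1 0 zy.
have y'c : is_conf e y' := homotopic_conf1 0 zy'.
apply: (homotopic_trans zy); apply: homotopic_trans (homotopic_sym zy').
have [kk'|kk'] := eqVneq k k'.
  by apply: (path_root_occupied IH yc y'c yk); rewrite kk'.
have [x [x' [xk x'k' xx']]] := path_swap kk' ess.
have xc : is_conf e x := homotopic_conf1 0 (homotopic_sym xx').
have x'c : is_conf e x' := homotopic_conf1 0 xx'.
apply: (homotopic_trans (path_root_occupied IH yc xc yk xk)).
apply: (homotopic_trans xx').
exact: (path_root_occupied IH x'c y'c x'k' y'k').
Qed.

End Connectedness.

(** * Contracting a stratum *)

Section Stratum.
Variables (R : realType) (V : finType) (e : rel V) (o : V) (p : V -> V).
Variables (dep : V -> nat) (c : V).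
Hypotheses (H : rooted e o p dep) (e_sym : symmetric e) (eirr : irreflexive e).
Hypotheses (eoc : e o c) (leaf_o : forall u, e o u -> u = c).

Local Notation point v t := (@edge_point R V p v t).
Local Notation ray := (@ray R V p dep).
Local Notation depth := (@depth R V dep).
Local Notation label := (@label R V e o p dep).

Variable n : nat.

(** The coordinate at [v] measures closeness to [v]. The bound one half makes the vertex unique, the
    strict maximum makes the particle unique, and both conditions are open. *)
Definition occupant (z : 'I_n -> V -> R) (v : V) (i : 'I_n) : bool :=
  (2^-1 < z i v) && [forall j, (j != i) ==> (z j v < z i v)].

(** An open relaxation of: the occupied essential vertices are exactly those of [S]. *)
Definition nearly_occupied (S : {set V}) (z : 'I_n -> V -> R) : Prop :=
  (forall v, v \in S -> essential e v /\ exists i, occupant z v i) /\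
  (forall w i, essential e w -> w \notin S -> z i w < 1).

Lemma occupant_inj z v i i' : occupant z v i -> occupant z v i' -> i = i'.
Proof.
move=> /andP[_ /forallP zi] /andP[_ /forallP zi'].
apply/eqP/negPn/negP => ii'.
have := zi i'; rewrite eq_sym ii' => /lt_trans/(_ (implyP (zi' i) ii')).
by rewrite ltxx.
Qed.

Lemma occupant_vertex_inj z v v' i : is_conf e z ->
  occupant z v i -> occupant z v' i -> v = v'.
Proof.
move=> [/(_ i)[z0 z1 _] _] /andP[zv _] /andP[zv' _].
apply/eqP/negPn/negP => vv'.
move: z1; rewrite (bigD1 v) //= (bigD1 v') 1?eq_sym //=.
have : 0 <= \sum_(w | (w != v) && (w != v')) z i w by rewrite sumr_ge0.
lra.
Qed.

Section Push_to_vertices.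
Variables (T : topologicalType) (f : T -> 'I_n -> V -> R) (S : T -> {set V}).
Hypotheses (fc : forall i w, continuous (fun t => f t i w)).
Hypotheses (fv : forall t, is_conf e (f t)).
Hypotheses (Sc : loc_const S) (fS : forall t, nearly_occupied (S t) (f t)).

Definition occupies t v i := (v \in S t) && occupant (f t) v i.

Lemma open_pred_occupant v i : open_pred (fun t => occupant (f t) v i).
Proof.
apply: open_pred_and.
  by apply: open_pred_lt; [exact: continuous_cst|exact: fc].
apply: open_pred_forall => j; apply: open_pred_imply.
by apply: open_pred_lt; exact: fc.
Qed.

(** Being the occupant is open. So is failing to be it, because [v] has some other occupant, which
    persists nearby. *)
Lemma loc_const_occupies v i : loc_const (fun t => occupies t v i).
Proof.
have lS : loc_const (fun t => v \in S t) by exact: (loc_const_comp (fun A : {set V} => v \in A) Sc).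
have oS : open_pred (fun t => v \in S t).
  by move=> t vS; apply: filterS (lS t) => u ->.
apply: loc_const_bool.
  by apply: open_pred_and; [exact: oS|exact: open_pred_occupant].
move=> t; rewrite /occupies; have [vS /=|vS _] := boolP (v \in S t); last first.
  by move: (lS t); apply: filterS => u ->; rewrite (negbTE vS).
move=> ni; have [_ [j oj]] := (fS t).1 v vS.
move: (open_pred_occupant oj); apply: filterS => u oju.
rewrite negb_and; apply/orP; right; apply: contra ni => oi.
by rewrite (occupant_inj oi oju).
Qed.

(** Occupants move straight to their vertices and the others rest: at most one term of the sum is
    nonzero. *)
Definition pushed (t : T) (s : R) (i : 'I_n) (w : V) : R :=
  f t i w + s * \sum_v (occupies t v i)%:R * ((w == v)%:R - f t i w).

Lemma continuous_pushed i w : continuous (fun x : T * R => pushed x.1 x.2 i w).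
Proof.
have cf : continuous (fun x : T * R => f x.1 i w).
  by apply: (@continuous_comp_fun _ _ _ fst (fun t => f t i w));
    [exact: continuous_fst|exact: fc].
apply: continuous_add => //; apply: continuous_mul; first exact: continuous_snd.
apply: continuous_bigsum => v; apply: continuous_mul.
  have lc := loc_const_cont (loc_const_occupies v i) (@continuous_fst T R).
  apply: (@loc_const_continuous _ _ _ (fun x : T * R => occupies x.1 v i)
           (fun b _ => b%:R : R) lc) => b.
  exact: continuous_cst.
by apply: continuous_sub => //; exact: continuous_cst.
Qed.

Lemma pushed_cases t i :
  (exists2 v, occupies t v i &
     forall s w, pushed t s i w = (1 - s) * f t i w + s * (w == v)%:R) \/
  ((forall v, ~~ occupies t v i) /\ forall s, pushed t s i = f t i).
Proof.
have [/existsP[v vi]|/existsPn no] := boolP [exists v, occupies t v i].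
  left; exists v => // s w; rewrite /pushed (bigD1 v) //= big1 ?vi ?addr0 => [|u uv].
    by rewrite mul1r; ring.
  case ui : (occupies t u i); last by rewrite mul0r.
  case/eqP: uv; move: ui vi => /andP[_ ui] /andP[_ vi].
  exact: occupant_vertex_inj (fv t) ui vi.
right; split=> // s; apply/funext => w; rewrite /pushed big1 ?mulr0 ?addr0 // => v _.
by rewrite (negbTE (no v)) mul0r.
Qed.

Lemma pushed_realization t s i : 0 <= s <= 1 ->
  realization_set R e (pushed t s i).
Proof.
move=> s01; have [fR _] := fv t.
case: (pushed_cases t i) => [[v vi vE]|[_ ->]]; last exact: fR.
have [u [r [nr fE]]] := realization_edge_point H e_sym eirr (fR i).
have r01 := normal01 nr.
have f0 : 0 < f t i v.
  by move: vi => /andP[_ /andP[+ _]]; apply: lt_trans; rewrite invr_gt0 ltr0n.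
(* A positive coordinate at [v] makes [v] an end of the edge carrying the particle, so the motion
   stays on that edge. *)
rewrite fE in f0; case: (edge_point_gt0 f0) => vu.
  have -> : pushed t s i = point u ((1 - s) * r).
    by apply/funext => w; rewrite vE fE vu /edge_point; ring.
  by apply: (edge_point_realization H); nra.
have -> : pushed t s i = point u ((1 - s) * r + s).
  by apply/funext => w; rewrite vE fE vu /edge_point; ring.
by apply: (edge_point_realization H); nra.
Qed.

Lemma pushed_conf t s : 0 <= s <= 1 -> is_conf e (pushed t s).
Proof.
move=> s01; split=> [i|]; first exact: pushed_realization.
have [fR fI] := fv t.
(* The coordinate at [v] separates the occupant of [v] from the others. *)
have sep i j v : occupies t v i -> j != i -> pushed t s i <> pushed t s j.
  move=> vi ji E; have := congr1 (fun z => z v) E.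
  have fij : f t j v < f t i v.
    by move: vi => /andP[_ /andP[_ /forallP/(_ j)]]; rewrite ji.
  have fiv := coordinate_bounds v (fR i); have fjv := coordinate_bounds v (fR j).
  case: (pushed_cases t i) => [[v' v'i ->]|[/(_ v)]]; last by rewrite vi.
  have <- : v = v'.
    move: vi v'i => /andP[_ vi] /andP[_ v'i].
    exact: occupant_vertex_inj (fv t) vi v'i.
  rewrite eqxx; case: (pushed_cases t j) => [[u uj ->]|[_ ->]] /=; last by nra.
  have /negbTE -> : v != u.
    apply: contra ji => /eqP vu; rewrite -vu in uj.
    move: vi uj => /andP[_ vi] /andP[_ uj].
    by rewrite (occupant_inj uj vi).
  by rewrite /=; nra.
move=> i j ij.
case: (pushed_cases t i) => [[v vi _]|[_ iE]].
  by apply: (sep _ _ v) => //; rewrite eq_sym.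
case: (pushed_cases t j) => [[v vj _]|[_ jE]].
  by move/esym; exact: (sep _ _ v).
by rewrite iE jE; exact: fI.
Qed.

Lemma homotopic_pushed : homotopic e f (fun t => pushed t 1).
Proof.
exists pushed; split=> //; first exact: continuous_pushed.
  by move=> t s; exact: pushed_conf.
by move=> t; apply/funext => i; apply/funext => w; rewrite /pushed mul0r addr0.
Qed.

Lemma pushed1_cases t i :
  (exists2 v, occupies t v i & pushed t 1 i = point v 1) \/
  (pushed t 1 i = f t i /\ ~~ at_essential e (f t i)).
Proof.
case: (pushed_cases t i) => [[v vi vE]|[no fE]].
  left; exists v => //; apply/funext => w.
  by rewrite vE subrr mul0r add0r mul1r edge_point1.
(* A particle that is not an occupant is at no essential vertex: outside [S] its coordinate is below
   one, and in [S] the coordinate of the occupant would exceed one. *)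
right; split=> //; apply/existsP => -[w /andP[wE /eqP fw]].
have [wS|wS] := boolP (w \in S t); last first.
  by have := (fS t).2 w i wE wS; rewrite fw ltxx.
have [_ [j wj]] := (fS t).1 w wS.
have [ij|ij] := eqVneq i j.
  by have := no w; rewrite /occupies wS ij wj.
have [fR _] := fv t; have := coordinate_bounds w (fR j).
by move: wj => /andP[_ /forallP/(_ i)]; rewrite ij fw /= => ?; lra.
Qed.

(** This is what pushing achieves: occupants now sit at locally constant vertices, and the other
    particles are away from the essential vertices, where labels are locally constant. *)
Lemma loc_const_label_pushed i : loc_const (fun t => label (pushed t 1 i)).
Proof.
have pc w : continuous (fun t => pushed t 1 i w).
  exact: (homotopic_continuous1 (i := i) (w := w) homotopic_pushed).
have pR t : realization_set R e (pushed t 1 i).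
  by apply: pushed_realization; rewrite ler01 lexx.
move=> t; case: (pushed1_cases t i) => [[v vi vE]|[fE nE]].
  have := loc_const_occupies v i t; apply: filterS => u ui.
  rewrite vi in ui; congr label; rewrite vE.
  case: (pushed_cases u i) => [[v' v'i uE]|[/(_ v)]]; last by rewrite ui.
  apply/funext => w; rewrite uE subrr mul0r add0r mul1r edge_point1.
  move: ui v'i => /andP[_ ui] /andP[_ v'i].
  by rewrite (occupant_vertex_inj (fv u) ui v'i).
rewrite -fE in nE.
exact: (loc_const_label H e_sym eirr eoc leaf_o pc pR nE).
Qed.

End Push_to_vertices.

Section Interpolation.
Variables (T : topologicalType) (g : T -> 'I_n -> V -> R).
Hypotheses (gc : forall i w, continuous (fun t => g t i w)).
Hypotheses (gv : forall t, is_conf e (g t)).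
Hypothesis lab : forall i, loc_const (fun t => label (g t i)).

(* The depths of particles with different labels are not compared, as that
   comparison is not locally constant. *)
Definition ctype (z : 'I_n -> V -> R) :
    {ffun 'I_n -> bool * V} * {ffun 'I_n * 'I_n -> bool} :=
  ([ffun i => label (z i)],
   [ffun ij => (label (z ij.1) == label (z ij.2)) &&
               (depth (z ij.1) < depth (z ij.2))]).

Lemma depth_neq (z : 'I_n -> V -> R) i j : is_conf e z -> i != j -> label (z i) = label (z j) ->
  depth (z i) != depth (z j).
Proof.
move=> [zR zI] ij lij; apply/eqP => dij; apply: (zI i j ij).
by rewrite -(label_ray H e_sym eirr (zR i)) -(label_ray H e_sym eirr (zR j)) lij dij.
Qed.

(** Distinct particles with the same label have different depths, so their comparison is strict and
    persists nearby. *)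
Lemma loc_const_ctype : loc_const (fun t => ctype (g t)).
Proof.
apply: loc_const_pair; apply: loc_const_ffun; first exact: lab.
move=> [i j] /= t; have dc k : continuous (fun t => depth (g t k)) by apply: continuous_depth; exact: gc.
move: (lab i t) (lab j t); apply: filter_app2.
have [lij|lij] := eqVneq (label (g t i)) (label (g t j)); last first.
  by apply: nearW => u -> ->; rewrite (negbTE lij).
have [<-|ij] := eqVneq i j; first by apply: nearW => u _ _; rewrite !ltxx !andbF.
have := depth_neq (gv t) ij lij; rewrite neq_lt => /orP[] dij.
  have := open_pred_lt (dc i) (dc j) dij; apply: filterS => u duij -> ->.
  by rewrite lij eqxx dij duij.
have := open_pred_lt (dc j) (dc i) dij; apply: filterS => u duij -> ->.
by rewrite lij eqxx !ltNge !ltW.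
Qed.

(** [b] picks one reference configuration for each type that occurs. Interpolating depths keeps
    labels and the order on each arc, so no collision occurs. *)
Lemma homotopic_base : exists b : _ -> 'I_n -> V -> R,
  (forall t, exists2 t', ctype (g t') = ctype (g t) & b (ctype (g t)) = g t') /\
  homotopic e g (fun t => b (ctype (g t))).
Proof.
have /choice[b bP] : forall k, exists y : 'I_n -> V -> R,
    forall t, ctype (g t) = k -> exists2 t', ctype (g t') = k & y = g t'.
  move=> k; have [[t tk]|no] := pselect (exists t, ctype (g t) = k).
    by exists (g t) => _ _; exists t.
  by exists (fun _ _ => 0) => t tk; case: no; exists t.
exists b; split; first by move=> t; exact: bP.
pose h t s i := ray (label (g t i)).2
  ((1 - s) * depth (g t i) + s * depth (b (ctype (g t)) i)).
have facts t : is_conf e (b (ctype (g t))) /\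
    ctype (b (ctype (g t))) = ctype (g t).
  by have [t' t't ->] := bP _ t erefl.
have labE t i : label (b (ctype (g t)) i) = label (g t i).
  have [_ /(congr1 fst)/ffunP/(_ i)] := facts t.
  by rewrite /= !ffunE.
have ordE t i j : label (g t i) = label (g t j) ->
    (depth (b (ctype (g t)) i) < depth (b (ctype (g t)) j)) =
    (depth (g t i) < depth (g t j)).
  move=> lij; have [_ /(congr1 snd)/ffunP/(_ (i, j))] := facts t.
  by rewrite /= !ffunE /= !labE lij eqxx.
exists h; split=> [i w|t s s01|t|t].
- have lc := loc_const_cont loc_const_ctype (@continuous_fst T R).
  (* The ray is read off from the type, so that for a fixed type the formula is visibly
     continuous. *)
  have -> : (fun x : T * R => h x.1 x.2 i w) = (fun x => ray
      ((ctype (g x.1)).1 i).2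
      ((1 - x.2) * depth (g x.1 i) + x.2 * depth (b (ctype (g x.1)) i)) w).
    by apply/funext => x; rewrite /h ffunE.
  apply: (@loc_const_continuous _ _ _ (fun x : T * R => ctype (g x.1))
    (fun k x => ray (k.1 i).2
       ((1 - x.2) * depth (g x.1 i) + x.2 * depth (b k i)) w) lc) => k.
  apply: continuous_ray; apply: continuous_add; apply: continuous_mul.
  + by apply: continuous_sub; [exact: continuous_cst|exact: continuous_snd].
  + apply: (@continuous_comp_fun _ _ _ fst (fun t => depth (g t i))).
      exact: continuous_fst.
    by apply: continuous_depth; exact: gc.
  + exact: continuous_snd.
  + exact: continuous_cst.
- have [[bR bI] _] := facts t; have [gR gI] := gv t.
  pose d i := (1 - s) * depth (g t i) + s * depth (b (ctype (g t)) i).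
  have between i : depth (g t i) <= d i <= depth (b (ctype (g t)) i) \/
                   depth (b (ctype (g t)) i) <= d i <= depth (g t i).
    by rewrite /d; case: (leP (depth (g t i)) (depth (b (ctype (g t)) i))) => dd;
      [left|right]; apply/andP; split; nra.
  have lh i : label (h t s i) = label (g t i).
    case: (between i) => dd.
      exact: (label_between H e_sym eirr (gR i) (bR i) (esym (labE t i)) dd).
    rewrite /h -labE.
    exact: (label_between H e_sym eirr (bR i) (gR i) (labE t i) dd).
  have dh i : depth (h t s i) = d i.
    have bound x : realization_set R e x -> 0 <= depth x <= (dep (label x).2)%:R.
      by move=> xR; exact: (depth_bounds H e_sym eirr xR (anc_bot H _)).
    apply: (depth_ray H); have := bound _ (gR i); have := bound _ (bR i).
    by rewrite labE; have := between i; rewrite /d; lra.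
  split=> [i|i j ij E]; first exact: (ray_realization H).
  have lij : label (g t i) = label (g t j) by rewrite -!lh E.
  have dij : d i = d j by rewrite -!dh E.
  wlog ltij : i j ij lij dij {E} / depth (g t i) < depth (g t j).
    move=> IH; have := depth_neq (gv t) ij lij; rewrite neq_lt => /orP[].
      exact: IH ij lij dij.
    by apply: IH; rewrite 1?eq_sym.
  have ltb : depth (b (ctype (g t)) i) < depth (b (ctype (g t)) j).
    by rewrite ordE.
  rewrite -subr_gt0 in ltij; rewrite -subr_gt0 in ltb; rewrite /d in dij.
  (* At the end the strict order in the reference configuration is used; before it, the contribution
     of [g] is already strictly positive. *)
  have [s1|s1] := eqVneq s 1; first by rewrite s1 in dij; lra.
  have gt0 : 0 < (1 - s) * (depth (g t j) - depth (g t i)).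
    by apply: mulr_gt0 => //; rewrite subr_gt0 lt_neqAle s1; case/andP: s01.
  have : 0 <= s * (depth (b (ctype (g t)) j) - depth (b (ctype (g t)) i)).
    by apply: mulr_ge0; [case/andP: s01|exact: ltW].
  by nra.
- apply/funext => i; rewrite /h subr0 mul1r mul0r addr0.
  by have [gR _] := gv t; exact: (label_ray H e_sym eirr (gR i)).
- apply/funext => i; rewrite /h subrr mul0r add0r mul1r -labE.
  by have [[bR _] _] := facts t; exact: (label_ray H e_sym eirr (bR i)).
Qed.

Hypothesis ess : exists r, essential e r.

(** Types are locally constant, so the path from the reference configuration to [z0] may be chosen
    separately for each type. *)
Lemma homotopic_cst z0 : is_conf e z0 -> homotopic e g (fun _ => z0).
Proof.
move=> z0c; have [b [bP gb]] := homotopic_base; apply: (homotopic_trans gb).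
have /choice[h hP] : forall k, exists h : R -> 'I_n -> V -> R,
    (forall i w, continuous (fun s => h s i w)) /\
    ((exists t, ctype (g t) = k) ->
     [/\ forall s, 0 <= s <= 1 -> is_conf e (h s), h 0 = b k & h 1 = z0]).
  move=> k; have [[t tk]|no] := pselect (exists t, ctype (g t) = k); last first.
    by exists (fun _ _ _ => 0); split=> // i w; exact: continuous_cst.
  have bc : is_conf e (b k) by have [t' _] := bP t; rewrite tk => ->.
  have conn := configurations_connected H e_sym eirr eoc leaf_o ess bc z0c.
  by have [h [hc hv h0 h1]] := path_elim conn; exists h.
have hPt t := (hP (ctype (g t))).2 (ex_intro _ t erefl).
exists (fun t => h (ctype (g t))); split=> [i w|t s s01|t|t].
- have lc := loc_const_cont loc_const_ctype (@continuous_fst T R).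
  apply: (@loc_const_continuous _ _ _ (fun x : T * R => ctype (g x.1))
    (fun k x => h k x.2 i w) lc) => k.
  apply: (@continuous_comp_fun _ _ _ snd (fun s => h k s i w)).
    exact: continuous_snd.
  exact: (hP k).1.
- by have [hv _ _] := hPt t; exact: hv.
- by have [_ ->] := hPt t.
- by have [] := hPt t.
Qed.

End Interpolation.

Lemma homotopic_stratum_cst (T : topologicalType) (f : T -> 'I_n -> V -> R)
    (S : T -> {set V}) z0 :
  (exists r, essential e r) -> (forall i w, continuous (fun t => f t i w)) ->
  (forall t, is_conf e (f t)) -> loc_const S ->
  (forall t, nearly_occupied (S t) (f t)) -> is_conf e z0 ->
  homotopic e f (fun _ => z0).
Proof.
move=> ess fc fv Sc fS z0c; have fp := homotopic_pushed fc fv Sc fS.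
apply: (homotopic_trans fp); apply: homotopic_cst => //.
- by move=> i w; exact: (homotopic_continuous1 (i := i) (w := w) fp).
- by move=> t; exact: (homotopic_conf1 t fp).
- exact: loc_const_label_pushed.
Qed.

End Stratum.

(** * The motion cover *)

Section Cover.
Variables (R : realType) (V : finType) (e : rel V) (n : nat).
Local Notation F := (configuration_space (realization R e) n).

(** Indexing by [V + V] lets one set record the vertices occupied in both configurations. *)
Definition pair_position (a : V + V) (u : F * F) (i : 'I_n) : R :=
  match a with inl v => position u.1 i v | inr v => position u.2 i v end.

Definition essential_sum : {set V + V} :=
  [set a | match a with inl v | inr v => essential e v end].

(* An open relaxation of: the essential vertices occupied in the pair [u] are
   exactly those of [W]. The last clause keeps apart the relaxations belonging
   to different sets of the same cardinality. *)
Definition dominant (W : {set V + V}) (u : F * F) : bool :=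
  [&& W \subset essential_sum,
      [forall a, (a \in W) ==> [exists i, (2^-1 < pair_position a u i) &&
         [forall j, (j != i) ==> (pair_position a u j < pair_position a u i)]]],
      [forall b, (b \in essential_sum :\: W) ==>
         [forall i, pair_position b u i < 1]] &
      [forall a, (a \in W) ==> [forall b, (b \in essential_sum :\: W) ==>
         [exists i, [forall j, pair_position b u j < pair_position a u i]]]]].

Lemma continuous_pair_position a i : continuous (fun u => pair_position a u i).
Proof.
case: a => v; rewrite /pair_position.
- apply: (@continuous_comp_fun _ _ _ fst (fun z : F => position z i v)).
    exact: continuous_fst.
  exact: continuous_position.
- apply: (@continuous_comp_fun _ _ _ snd (fun z : F => position z i v)).
    exact: continuous_snd.
  exact: continuous_position.
Qed.

Lemma open_pred_dominant W : open_pred (dominant W).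
Proof.
have lt a i b j : open_pred (fun u => pair_position a u i < pair_position b u j).
  by apply: open_pred_lt; exact: continuous_pair_position.
apply: open_pred_and; first exact: open_pred_cst.
apply: open_pred_and; [|apply: open_pred_and].
- apply: open_pred_forall => a; apply: open_pred_imply.
  apply: open_pred_exists => i; apply: open_pred_and.
    by apply: open_pred_lt;
      [exact: continuous_cst|exact: continuous_pair_position].
  by apply: open_pred_forall => j; apply: open_pred_imply; exact: lt.
- apply: open_pred_forall => b; apply: open_pred_imply.
  apply: open_pred_forall => i; apply: open_pred_lt.
    exact: continuous_pair_position.
  exact: continuous_cst.
- apply: open_pred_forall => a; apply: open_pred_imply.
  apply: open_pred_forall => b; apply: open_pred_imply.
  by apply: open_pred_exists => i; apply: open_pred_forall => j; exact: lt.
Qed.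

(** Distinct sets of equal size would give [a] and [b], each in just one of them. By the last clause
    the largest coordinate at [a] would then both exceed and be exceeded by the one at [b]. *)
Lemma dominant_inj W W' u :
  dominant W u -> dominant W' u -> #|W| = #|W'| -> W = W'.
Proof.
have sub W1 W2 : dominant W1 u -> dominant W2 u -> #|W1| = #|W2| ->
    W1 \subset W2.
  move=> /and4P[E1 _ _ /forallP d1] /and4P[E2 _ _ /forallP d2] cW.
  have [//|/subsetPn[a aW1 aW2]] := boolP (W1 \subset W2).
  have /subsetPn[b bW2 bW1] : ~~ (W2 \subset W1).
    apply: contra aW2 => W21; have /eqP -> // : W2 == W1.
    by rewrite eqEcard W21 cW leqnn.
  have aE := fintype.subsetP E1 a aW1; have bE := fintype.subsetP E2 b bW2.
  have /existsP[i /forallP ab] : [exists i, [forall j,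
      pair_position b u j < pair_position a u i]].
    by move: (d1 a); rewrite aW1 => /forallP/(_ b); rewrite finset.in_setD bW1 bE.
  have /existsP[j /forallP ba] : [exists i, [forall j,
      pair_position a u j < pair_position b u i]].
    by move: (d2 b); rewrite bW2 => /forallP/(_ a); rewrite finset.in_setD aW2 aE.
  by have := lt_trans (ab j) (ba i); rewrite ltxx.
by move=> dW dW' cW; apply/eqP; rewrite finset.eqEsubset !sub.
Qed.

Definition stratum (r : nat) : set (F * F) :=
  [set u | [exists W : {set V + V}, (#|W| == r) && dominant W u]].

Lemma open_stratum r : open (stratum r).
Proof.
have oS : open_pred (fun u =>
    [exists W : {set V + V}, (#|W| == r) && dominant W u]).
  apply: open_pred_exists => W; apply: open_pred_and.
    exact: open_pred_cst.
  exact: open_pred_dominant.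
by rewrite openE => u /oS.
Qed.

Lemma card_essential_sum : (#|essential_sum| <= 2 * num_essential e)%N.
Proof.
pose E := [set v | essential e v]%SET.
have sub : essential_sum \subset (inl @: E) :|: (inr @: E).
  apply/fintype.subsetP => -[v|v]; rewrite !inE => vE; apply/orP.
    by left; apply/imsetP; exists v; rewrite ?inE.
  by right; apply/imsetP; exists v; rewrite ?inE.
have cE : #|E| = num_essential e by rewrite cardsE.
apply: leq_trans (subset_leq_card sub) (leq_trans (leq_card_setU _ _) _).
by rewrite !card_imset ?cE ?mul2n ?addnn // => ? ? [].
Qed.

Lemma stratum_cover u : exists2 r, (r < 2 * num_essential e + 1)%N & stratum r u.
Proof.
(* For the vertices that are actually occupied, the occupant has coordinate one, and every other
   coordinate being compared is smaller. *)
pose W := [set a in essential_sum | [exists i, pair_position a u i == 1]]%SET.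
have WE : W \subset essential_sum by apply/fintype.subsetP => a; rewrite inE => /andP[].
exists #|W|; first by rewrite addn1 ltnS (leq_trans (subset_leq_card WE)) ?card_essential_sum.
apply/existsP; exists W; rewrite eqxx /=.
have le1 a i : pair_position a u i <= 1.
  by case: a => v; have [/(_ i) zR _] := position_is_conf u.1;
    have [/(_ i) zR' _] := position_is_conf u.2;
    [case/andP: (coordinate_bounds v zR)|case/andP: (coordinate_bounds v zR')].
have uniq1 a i j : pair_position a u i = 1 -> pair_position a u j = 1 -> i = j.
  move=> ai aj; apply/eqP/negPn/negP => ij.
  case: a ai aj => v /= ai aj.
    have [zR zI] := position_is_conf u.1; apply: (zI i j ij).
    (* No rooting is fixed here; with parameter one any parent map, such as [id], describes the
       vertex. *)
    by rewrite (realization_vertex id (zR i) ai) (realization_vertex id (zR j) aj).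
  have [zR zI] := position_is_conf u.2; apply: (zI i j ij).
  by rewrite (realization_vertex id (zR i) ai) (realization_vertex id (zR j) aj).
have inW a : a \in W -> exists i, pair_position a u i = 1.
  by rewrite inE => /andP[_ /existsP[i /eqP ai]]; exists i.
have outW b : b \in essential_sum :\: W -> forall i, pair_position b u i < 1.
  rewrite !inE => /andP[+ bE] i; rewrite bE /= => /existsPn/(_ i) bi.
  by rewrite lt_neqAle bi le1.
apply/and4P; split=> //; apply/forallP => a; apply/implyP.
- case/inW => i ai; apply/existsP; exists i; rewrite ai invf_lt1 ?ltr1n //=.
  apply/forallP => j; apply/implyP => ji; rewrite lt_neqAle le1 andbT.
  by apply: contra ji => /eqP aj; rewrite (uniq1 a j i).
- by move=> /outW ai; apply/forallP.
- case/inW => i ai; apply/forallP => b; apply/implyP => /outW bj.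
  by apply/existsP; exists i; apply/forallP => j; rewrite ai.
Qed.

Lemma dominant_nearly_occupied W u : dominant W u ->
  nearly_occupied e [set v | inl v \in W] (position u.1) /\
  nearly_occupied e [set v | inr v \in W] (position u.2).
Proof.
move=> /and4P[/fintype.subsetP WE /forallP occ /forallP free _].
split; split=> [v|v i vE].
- rewrite inE => vW; split; first by move: (WE _ vW); rewrite inE.
  by have /existsP[i oi] := implyP (occ (inl v)) vW; exists i.
- rewrite inE => vW.
  have fv : inl v \in essential_sum :\: W by rewrite finset.in_setD vW inE.
  exact: (forallP (implyP (free (inl v)) fv) i).
- rewrite inE => vW; split; first by move: (WE _ vW); rewrite inE.
  by have /existsP[i oi] := implyP (occ (inr v)) vW; exists i.
- rewrite inE => vW.
  have fv : inr v \in essential_sum :\: W by rewrite finset.in_setD vW inE.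
  exact: (forallP (implyP (free (inr v)) fv) i).
Qed.

(** Both projections are contracted to the same constant configuration, so they are homotopic to
    each other. *)
Lemma stratum_local_section r : is_tree e -> (exists v, essential e v) ->
  has_local_section R (stratum r).
Proof.
move=> tree_e ess; have [e_sym eirr _ _] := tree_e.
have [x [c [exc leaf_x]]] := exists_leaf tree_e ess.
have [p [dep H]] := exists_rooted tree_e x.
apply: homotopic_has_local_section.
have /choice[W WP] : forall u : set_type (stratum r), exists W : {set V + V},
    #|W| = r /\ dominant W (\val u).
  by move=> u; have /existsP[W /andP[/eqP Wr Wu]] := set_valP u; exists W.
(* Domination by [W u] persists near [u], and only one set of size [r] can dominate. *)
have lW : loc_const W.
  move=> u; have : \forall u' \near u, dominant (W u) (\val u').
    exact: (@continuous_set_val _ _ u _ (open_pred_dominant (WP u).2)).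
  apply: filterS => u' du'.
  by apply: (dominant_inj (WP u').2 du'); rewrite (WP u').1 (WP u).1.
(* If there is no configuration, the stratum is empty and any formula serves. *)
have [[z0 _]|no] := pselect (exists z : F, True); last first.
  have noU (u : set_type (stratum r)) : False.
    by apply: no; exists (\val u).1.
  exists (fun _ _ _ _ => 0); split=> [i w|u|u|u]; try by case: (noU u).
  by move=> [u s]; case: (noU u).
have cst (proj : F * F -> F) (inj : V -> V + V) : continuous proj ->
    (forall W u, dominant W u ->
       nearly_occupied e [set v | inj v \in W] (position (proj u))) ->
    homotopic e (fun u : set_type (stratum r) => position (proj (\val u)))
      (fun _ => position z0).
  move=> cproj near_occ.
  apply: (homotopic_stratum_cst H e_sym eirr exc leaf_x
    (f := fun u : set_type (stratum r) => position (proj (\val u)))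
    (S := fun u => [set v | inj v \in W u]%SET)) => //.
  - move=> i w; apply: (@continuous_comp_fun _ _ _
      (fun u : set_type (stratum r) => \val u)
      (fun u : F * F => position (proj u) i w)); first exact: continuous_set_val.
    apply: (@continuous_comp_fun _ _ _ proj (fun z : F => position z i w)) => //.
    exact: continuous_position.
  - by move=> u; exact: position_is_conf.
  - exact: (loc_const_comp (fun W : {set V + V} => [set v | inj v \in W]%SET) lW).
  - by move=> u; exact: near_occ (WP u).2.
  - exact: position_is_conf.
apply: (homotopic_trans (cst fst inl _ _)).
- exact: continuous_fst.
- by move=> W' u /dominant_nearly_occupied[].
apply: homotopic_sym; apply: (cst snd inr).
- exact: continuous_snd.
- by move=> W' u /dominant_nearly_occupied[].
Qed.

End Cover.

Theorem corollary10p2 (R : realType) (V : finType) (e : rel V)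
    (tree_e : is_tree e) (ess : exists v : V, essential e v)
    (n : nat) (n_ge1 : (1 <= n)%N) :
  (TC R (configuration_space (realization R e) n)
     <= (2 * num_essential e + 1)%:R%:E)%E.
Proof.
apply: ereal_inf_lbound; exists (2 * num_essential e + 1)%N => //.
exists (fun r => stratum (r : nat)); split=> [r||r].
- exact: open_stratum.
- rewrite eqEsubset; split=> // u _; have [r rm ur] := stratum_cover u.
  by exists (Ordinal rm).
- exact: stratum_local_section.
Qed.
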